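(* Let $g\geq1$ and $$S_g=\langle a_1,\dots,a_g,b_1,\dots,b_g\mid[a_1,b_1]\cdots[a_g,b_g]=1\rangle.$$ Let $P$ be a finite set of powers of the generators $\{a_1,a_1^{-1},\dots,a_g,a_g^{-1},b_1,b_1^{-1},\dots,b_g,b_g^{-1}\}$ of $S_g$. Then membership in the submonoid of $S_g$ generated by $P$ is decidable.
   Context: $[a,b]=aba^{-1}b^{-1}$. For a group $G$ generated by a finite set $B$ and a finitely generated submonoid $M\leq G$, membership in $M$ is decidable if there is an algorithm that takes any word over $B\cup B^{-1}$ and decides whether the element of $G$ it represents belongs to $M$. *)

(* Defs.v *)
From HB Require Import structures.
From mathcomp Require Import all_boot.
From mathcomp Require Import generic_quotient.
From mathcomp Require Import boolp classical_sets cardinality.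
Set Implicit Arguments.
Unset Strict Implicit.
Unset Printing Implicit Defensive.

Local Open Scope classical_set_scope.
Local Open Scope quotient_scope.

(* The least class of functions on tuples of natural numbers that contains the
   constant zero, the successor and the projections and is closed under
   composition, primitive recursion and minimisation of functions which have a
   zero everywhere.  By Church's thesis these are the functions computable by
   an (always terminating) algorithm. *)
Inductive recursive : forall n, (n.-tuple nat -> nat) -> Prop :=
| rec_zero n : recursive (fun _ : n.-tuple nat => 0)
| rec_succ : recursive (fun x : 1.-tuple nat => (thead x).+1)
| rec_proj n (i : 'I_n) : recursive (fun x : n.-tuple nat => tnth x i)
| rec_comp m n (f : m.-tuple nat -> nat) (h : 'I_m -> n.-tuple nat -> nat) :
    recursive f -> (forall i, recursive (h i)) ->
    recursive (fun x : n.-tuple nat => f [tuple h i x | i < m])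
| rec_prim n (f : n.-tuple nat -> nat) (h : n.+2.-tuple nat -> nat) :
    recursive f -> recursive h ->
    recursive (fun x : n.+1.-tuple nat =>
      iteri (thead x) (fun k r => h [tuple of k :: r :: behead x])
            (f [tuple of behead x]))
| rec_mu n (f : n.+1.-tuple nat -> nat) (mu : n.-tuple nat -> nat) :
    recursive f ->
    (forall x, f [tuple of mu x :: x] = 0) ->
    (forall x k, k < mu x -> f [tuple of k :: x] <> 0) ->
    recursive mu.

(* Bijective numeration in base #|A|: the letters of A are the digits
   1, ..., #|A|, and the first letter is the least significant digit. *)
Definition word_code (A : finType) (w : seq A) : nat :=
  foldr (fun x c => (enum_rank x).+1 + #|A| * c) 0 w.

Definition decidable_language (A : finType) (L : set (seq A)) : Prop :=
  exists2 f : 1.-tuple nat -> nat, recursive f &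
    forall w : seq A, f [tuple word_code w] = nat_of_bool `[< L w >].

Local Open Scope group_scope.

(* The letter (b, false) stands for b and (b, true) for b^-1. *)
Definition word (B : Type) : Type := seq (B * bool).

Definition word_inv (B : Type) (w : word B) : word B :=
  rev [seq (x.1, ~~ x.2) | x <- w].

Definition word_comm (B : Type) (u v : word B) : word B :=
  u ++ v ++ word_inv u ++ word_inv v.

Definition letter_eval (B : Type) (G : groupType) (gen : B -> G)
    (x : B * bool) : G :=
  if x.2 then (gen x.1)^-1 else gen x.1.

Definition word_eval (B : Type) (G : groupType) (gen : B -> G)
    (w : word B) : G :=
  \prod_(x <- w) letter_eval gen x.

(* The least congruence on words that contains the free cancellations
   x x^-1 = 1 and the relations r = 1 for r in R; two words are related exactly
   when they represent the same element of <B | R>. *)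
Inductive word_equiv (B : Type) (R : set (word B)) : word B -> word B -> Prop :=
| we_refl u : word_equiv R u u
| we_sym u v : word_equiv R u v -> word_equiv R v u
| we_trans v u w : word_equiv R u v -> word_equiv R v w -> word_equiv R u w
| we_cat u u' v v' :
    word_equiv R u u' -> word_equiv R v v' -> word_equiv R (u ++ v) (u' ++ v')
| we_cancel b e : word_equiv R [:: (b, e); (b, ~~ e)] [::]
| we_relator r : R r -> word_equiv R r [::].

Section PresentedGroup.
Variables (B : choiceType) (R : set (word B)).

Definition word_equivb : rel (seq (B * bool)) :=
  fun u v => `[< word_equiv R u v >].

Lemma word_equivb_refl : reflexive word_equivb.
Proof. by move=> u; apply/asboolP/we_refl. Qed.

Lemma word_equivb_sym : symmetric word_equivb.
Proof. by move=> u v; apply/asboolP/asboolP => /we_sym. Qed.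

Lemma word_equivb_trans : transitive word_equivb.
Proof.
by move=> v u w /asboolP uv /asboolP vw; apply/asboolP; apply: we_trans uv vw.
Qed.

Canonical word_equiv_rel :=
  EquivRel word_equivb word_equivb_refl word_equivb_sym word_equivb_trans.

Definition presented : Type := {eq_quot word_equivb}.

HB.instance Definition _ := Choice.on presented.
HB.instance Definition _ := Quotient.on presented.

Definition word_class (w : word B) : presented := \pi_presented w.

Lemma word_classP u v : word_class u = word_class v <-> word_equiv R u v.
Proof. by split=> [/eqmodP/asboolP | uv]; last exact/eqmodP/asboolP. Qed.

Lemma word_class_repr (x : presented) : word_class (repr x) = x.
Proof. exact: reprK. Qed.

Lemma word_equiv_repr w : word_equiv R (repr (word_class w)) w.
Proof. by apply/word_classP; rewrite word_class_repr. Qed.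

Lemma word_invK : involutive (@word_inv B).
Proof.
move=> w; rewrite /word_inv map_rev revK -map_comp -[RHS]map_id.
by apply: eq_map => -[b e] /=; rewrite negbK.
Qed.

Lemma word_inv_cat (u v : word B) :
  word_inv (u ++ v) = word_inv v ++ word_inv u.
Proof. by rewrite /word_inv map_cat rev_cat. Qed.

Lemma word_equiv_mulV (u : word B) : word_equiv R (u ++ word_inv u) [::].
Proof.
elim: u => [|[b e] u IHu]; first exact: we_refl.
rewrite -cat1s word_inv_cat -catA (catA u).
apply: (@we_trans _ _ ([:: (b, e)] ++ [::] ++ word_inv [:: (b, e)])).
  apply: we_cat; first exact: we_refl.
  by apply: we_cat; [exact: IHu | exact: we_refl].
exact: we_cancel.
Qed.

Lemma word_equiv_inv (u v : word B) :
  word_equiv R u v -> word_equiv R (word_inv u) (word_inv v).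
Proof.
move=> uv.
apply: (@we_trans _ _ (word_inv u ++ v ++ word_inv v)).
  rewrite -[X in word_equiv _ X _]cats0; apply: we_cat; first exact: we_refl.
  exact/we_sym/word_equiv_mulV.
rewrite catA -[X in word_equiv _ _ X]cat0s; apply: we_cat; last exact: we_refl.
apply: (@we_trans _ _ (word_inv u ++ u)).
  by apply: we_cat; [exact: we_refl | exact: we_sym].
by rewrite -[X in _ ++ X]word_invK; apply: word_equiv_mulV.
Qed.

Definition presented_mul (x y : presented) := word_class (repr x ++ repr y).
Definition presented_inv (x : presented) := word_class (word_inv (repr x)).

Lemma presented_mulE u v :
  presented_mul (word_class u) (word_class v) = word_class (u ++ v).
Proof. by apply/word_classP/we_cat; apply: word_equiv_repr. Qed.

Lemma presented_invE u :
  presented_inv (word_class u) = word_class (word_inv u).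
Proof. exact/word_classP/word_equiv_inv/word_equiv_repr. Qed.

Lemma presented_mulA : associative presented_mul.
Proof.
move=> x y z; rewrite -(word_class_repr x) -(word_class_repr y).
by rewrite -(word_class_repr z) !presented_mulE catA.
Qed.

Lemma presented_mul1 : left_id (word_class [::]) presented_mul.
Proof. by move=> x; rewrite -(word_class_repr x) presented_mulE. Qed.

Lemma presented_mulr1 : right_id (word_class [::]) presented_mul.
Proof. by move=> x; rewrite -(word_class_repr x) presented_mulE cats0. Qed.

Lemma presented_mulV :
  left_inverse (word_class [::]) presented_inv presented_mul.
Proof.
move=> x; rewrite -(word_class_repr x) presented_invE presented_mulE.
apply/word_classP; rewrite -[X in _ ++ X]word_invK.
exact: word_equiv_mulV.
Qed.

Lemma presented_mulrV :
  right_inverse (word_class [::]) presented_inv presented_mul.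
Proof.
move=> x; rewrite -(word_class_repr x) presented_invE presented_mulE.
exact/word_classP/word_equiv_mulV.
Qed.

HB.instance Definition _ := isGroup.Build presented
  presented_mulA presented_mul1 presented_mulr1 presented_mulV presented_mulrV.

Definition presented_gen (b : B) : presented := word_class [:: (b, false)].

Lemma word_eval_presented w : word_eval presented_gen w = word_class w.
Proof.
rewrite /word_eval; elim: w => [|[b e] w IHw]; first by rewrite big_nil.
rewrite big_cons {}IHw -cat1s -presented_mulE /letter_eval.
by congr (_ * _); case: e => //=; apply: presented_invE.
Qed.

Lemma presented_generated (x : presented) :
  exists w, word_eval presented_gen w = x.
Proof. by exists (repr x); rewrite word_eval_presented word_class_repr. Qed.

End PresentedGroup.

Definition is_submonoid (G : groupType) (M : set G) : Prop :=
  M 1 /\ forall x y, M x -> M y -> M (x * y).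

Definition submonoid_gen (G : groupType) (P : set G) : set G :=
  smallest (@is_submonoid G) P.

(* Meant for a family gen whose values generate G. *)
Definition membership_decidable (B : finType) (G : groupType) (gen : B -> G)
    (M : set G) : Prop :=
  decidable_language [set w : seq (B * bool) | M (word_eval gen w)].

(* inl i is the generator a_{i+1} and inr i the generator b_{i+1}. *)
Definition surface_letters (g : nat) : finType := ('I_g + 'I_g)%type.

Definition surface_relator (g : nat) : word (surface_letters g) :=
  flatten [seq word_comm [:: (inl i, false)] [:: (inr i, false)]
          | i <- enum 'I_g].

Definition surface_group (g : nat) : groupType :=
  @presented (surface_letters g) [set surface_relator g].

Definition surface_gen (g : nat) : surface_letters g -> surface_group g :=
  @presented_gen (surface_letters g) [set surface_relator g].

Lemma surface_relation (g : nat) :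
  \prod_(i < g) (surface_gen (inl i) * surface_gen (inr i)
                 * (surface_gen (inl i))^-1 * (surface_gen (inr i))^-1)
  = 1 :> surface_group g.
Proof.
have rel1 : word_eval (@surface_gen g) (surface_relator g) = 1.
  by rewrite word_eval_presented; apply/word_classP/we_relator.
rewrite -[RHS]rel1 /word_eval /surface_relator big_flatten big_map
  enumT [index_enum _]unlock.
apply: eq_bigr => i _.
by rewrite /= !big_cons big_nil /letter_eval /= mulg1 !mulgA.
Qed.

Definition generator_powers (g : nat) : set (surface_group g) :=
  [set x | exists (l : surface_letters g * bool) (n : nat),
     x = letter_eval (@surface_gen g) l ^+ n].

(* Main.v *)
Require Import Defs.
From HB Require Import structures.
From mathcomp Require Import all_boot ssralg ssrint.
From mathcomp Require Import boolp classical_sets cardinality.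
From mathcomp Require Import zify.
Set Implicit Arguments.
Unset Strict Implicit.
Unset Printing Implicit Defensive.

(** Let g >= 2 and cut the surface along the curve that separates the first handle
    from the others. Then S_g is the amalgam of the free groups A on a_1, b_1 and B
    on the other generators along the infinite cyclic group generated by
    z = [a_1, b_1] = ([a_2, b_2] ... [a_g, b_g])^-1. Every element has an alternating
    expression u_1 u_2 ... u_k with factors in A and in B but not in <z>, and two such
    expressions of an element differ only by powers of z that are passed from a factor
    to the next one ([shifted_of_acts], proved with the permutation representation on
    normal forms). An alternating expression can be computed letter by letter
    ([reduced_form]), which solves the word problem.

    Let M be the submonoid. Each element of P lies in A or in B. If M contains all of
    A or all of B then it contains z and z^-1. Then M meets A and B in finitely
    generated submonoids, and an alternating product is in M if and only if its factors
    are in these submonoids. Otherwise an element of A that is a product of elements of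
    P has a reduced word composed of syllables x^n in M. If this word
    begins with a period of z or z^-1 and one more letter, then all letters of this
    period are syllables, so that M contains A; thus if z^m u is such a product then |m| is
    bounded by the length of u ([zpow_bound]), and likewise in B. In particular no
    nontrivial power of z is in M. Hence the powers of z that turn a computed
    alternating expression into one with factors in M are bounded, one after the
    other, in terms of this expression.

    In both cases it remains to bound the number of generators needed to write a given
    element of a finitely generated submonoid of a free group; Benois' argument gives a
    linear bound in the length of the element ([bounded_product]). So an element of M is
    a product of at most f(w) elements of P, where w is any word for it and f is
    computable ([length_boundP]). A finite search with the help of the word problem then
    decides membership ([decidable_products]). For g = 1 the free groups on a_1 and on
    b_1 commute with each other, and the same search applies, with a bound obtained from
    the two projections ([decidable_commuting]).

    The algorithms are recursive functions because the computable functions between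
    types whose elements are encoded by numbers are closed under pairing, case
    distinction and iteration over lists. *)

(** * Recursive functions of few arguments *)

Lemma recursive_ext n (f g : n.-tuple nat -> nat) :
  recursive f -> f =1 g -> recursive g.
Proof. by move=> rf /funext <-. Qed.

Lemma recursive_nth n i : recursive (fun x : n.-tuple nat => nth 0 x i).
Proof.
have [lt_in | le_ni] := ltnP i n.
  apply: recursive_ext (rec_proj (Ordinal lt_in)) _ => x.
  by rewrite (tnth_nth 0).
apply: recursive_ext (rec_zero n) _ => x.
by rewrite nth_default // size_tuple.
Qed.

Definition rec1 (f : nat -> nat) :=
  recursive (fun x : 1.-tuple nat => f (nth 0 x 0)).
Definition rec2 (f : nat -> nat -> nat) :=
  recursive (fun x : 2.-tuple nat => f (nth 0 x 0) (nth 0 x 1)).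
Definition rec3 (f : nat -> nat -> nat -> nat) :=
  recursive (fun x : 3.-tuple nat => f (nth 0 x 0) (nth 0 x 1) (nth 0 x 2)).

Lemma nth_eval_tuple m n (hs : m.-tuple (n.-tuple nat -> nat)) x j :
  nth 0 [tuple tnth hs i x | i < m] j = nth (fun _ => 0) hs j x.
Proof.
have [lt_jm | le_mj] := ltnP j m; last by rewrite !nth_default ?size_tuple.
rewrite -[j]/(val (Ordinal lt_jm)) -tnth_nth tnth_mktuple.
by rewrite (tnth_nth (fun _ => 0)).
Qed.

Lemma recursive_subst m n (f : m.-tuple nat -> nat)
    (hs : m.-tuple (n.-tuple nat -> nat)) :
    recursive f -> (forall j, recursive (nth (fun _ => 0) hs j)) ->
  recursive (fun x => f [tuple tnth hs i x | i < m]).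
Proof.
move=> rf rh; apply: rec_comp => // i.
by rewrite (tnth_nth (fun _ => 0)).
Qed.

Section Substitution.
Variables (n : nat) (h1 h2 h3 : n.-tuple nat -> nat).
Hypotheses (r1 : recursive h1) (r2 : recursive h2) (r3 : recursive h3).

Lemma rec1_subst f : rec1 f -> recursive (fun x => f (h1 x)).
Proof.
move=> rf; apply: recursive_ext
  (recursive_subst (hs := [tuple of [:: h1]]) rf _) _ => [|x].
  by case=> [|[|j]] //=; apply: rec_zero.
by rewrite /= nth_eval_tuple.
Qed.

Lemma rec2_subst f : rec2 f -> recursive (fun x => f (h1 x) (h2 x)).
Proof.
move=> rf; apply: recursive_ext
  (recursive_subst (hs := [tuple of [:: h1; h2]]) rf _) _ => [|x].
  by case=> [|[|[|j]]] //=; apply: rec_zero.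
by rewrite /= !nth_eval_tuple.
Qed.

Lemma rec3_subst f : rec3 f -> recursive (fun x => f (h1 x) (h2 x) (h3 x)).
Proof.
move=> rf; apply: recursive_ext
  (recursive_subst (hs := [tuple of [:: h1; h2; h3]]) rf _) _ => [|x].
  by case=> [|[|[|[|j]]]] //=; apply: rec_zero.
by rewrite /= !nth_eval_tuple.
Qed.

End Substitution.

Lemma rec_const n c : recursive (fun _ : n.-tuple nat => c).
Proof.
elim: c => [|c IHc]; first exact: rec_zero.
apply: (@rec1_subst _ (fun _ => c) IHc succn).
apply: recursive_ext rec_succ _ => x.
by rewrite /thead (tnth_nth 0).
Qed.

(** Primitive recursion with one parameter is enough, since several
    parameters can be packed into one by a pairing function. *)
Lemma rec2_iteri b s : rec1 b -> rec3 s ->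
  rec2 (fun k p => iteri k (fun i r => s i r p) (b p)).
Proof.
move=> rb rs; apply: recursive_ext (rec_prim rb rs) _ => x.
rewrite /thead (tnth_nth 0) nth_behead; apply: eq_iteri => i r.
by rewrite /= nth_behead.
Qed.

Lemma rec1_const c : rec1 (fun _ => c). Proof. exact: rec_const. Qed.

Lemma rec1_id : rec1 id. Proof. exact: recursive_nth. Qed.

Lemma rec1_succ : rec1 succn.
Proof.
by apply: recursive_ext rec_succ _ => x; rewrite /thead (tnth_nth 0).
Qed.

Lemma rec2_iter (f : nat -> nat) : rec1 f -> rec2 (fun k p => iter k f p).
Proof.
move=> rf; apply: recursive_ext (rec2_iteri rec1_id (_ : rec3 (fun _ r _ => f r))) _.
  by apply: rec1_subst rf; apply: recursive_nth.
by move=> x /=; elim: (nth 0 x 0) => //= k ->.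
Qed.

Lemma rec2_add : rec2 addn.
Proof.
apply: recursive_ext (rec2_iter rec1_succ) _ => x.
by elim: (nth 0 x 0) => //= k ->.
Qed.

Lemma rec1_pred : rec1 predn.
Proof.
have r := rec2_iteri (rec1_const 0) (recursive_nth 3 0 : rec3 (fun i _ _ => i)).
apply: recursive_ext (rec2_subst (recursive_nth 1 0) (rec_const 1 0) r) _ => x.
by case: (nth 0 x 0).
Qed.

Lemma rec2_sub : rec2 subn.
Proof.
have r := rec2_subst (recursive_nth 2 1) (recursive_nth 2 0) (rec2_iter rec1_pred).
apply: recursive_ext r _ => x; elim: (nth 0 x 1) => [|k /= ->]; first by rewrite subn0.
by rewrite subnS.
Qed.

Lemma rec2_mul : rec2 muln.
Proof.
have r := rec2_iteri (rec1_const 0)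
  (rec2_subst (recursive_nth 3 1) (recursive_nth 3 2) rec2_add
   : rec3 (fun _ r p => r + p)).
apply: recursive_ext r _ => x; elim: (nth 0 x 0) => //= k ->.
by rewrite mulSn addnC.
Qed.

(** With truncated subtraction 1 - c is the test for c = 0, so that a conditional is a
    sum of products. *)
Lemma rec3_if : rec3 (fun c x y => if c is 0 then y else x).
Proof.
have r0 := recursive_nth 3 0; have r1 := recursive_nth 3 1.
have r2 := recursive_nth 3 2.
have rz : rec3 (fun c _ _ => 1 - c) := rec2_subst (rec_const 3 1) r0 rec2_sub.
have rnz : rec3 (fun c _ _ => 1 - (1 - c)) := rec2_subst (rec_const 3 1) rz rec2_sub.
have r := rec2_subst (rec2_subst rnz r1 rec2_mul) (rec2_subst rz r2 rec2_mul) rec2_add.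
apply: recursive_ext r _ => x; case: (nth 0 x 0) => [|c] /=; lia.
Qed.

(** The number (x + y)^2 + x is less than (x + y + 1)^2, so x + y is its integer square
    root, which is defined by primitive recursion. *)
Definition isqrt n := iteri n (fun i r => if r.+1 ^ 2 <= i.+1 then r.+1 else r) 0.
Definition npair x y := (x + y) ^ 2 + x.
Definition nfst n := n - isqrt n ^ 2.
Definition nsnd n := isqrt n - nfst n.

Lemma isqrtP n : isqrt n ^ 2 <= n < (isqrt n).+1 ^ 2.
Proof.
elim: n => //= n; rewrite /isqrt /=; set r := iteri _ _ _.
by case: ifP; nia.
Qed.

Lemma isqrt_pair x y : isqrt (npair x y) = x + y.
Proof. by have := isqrtP (npair x y); rewrite /npair; nia. Qed.

Lemma npairK1 x y : nfst (npair x y) = x.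
Proof. by rewrite /nfst isqrt_pair /npair; lia. Qed.

Lemma npairK2 x y : nsnd (npair x y) = y.
Proof. by rewrite /nsnd isqrt_pair npairK1; lia. Qed.

Lemma leq_npair x y : y <= npair x y.
Proof. by rewrite /npair; nia. Qed.

Lemma rec2_pair : rec2 npair.
Proof.
have rs := rec2_subst (recursive_nth 2 0) (recursive_nth 2 1) rec2_add.
apply: recursive_ext
  (rec2_subst (rec2_subst rs rs rec2_mul) (recursive_nth 2 0) rec2_add) _ => x.
by rewrite mulnn.
Qed.

Lemma rec1_isqrt : rec1 isqrt.
Proof.
have rS := rec1_subst (recursive_nth 3 1) rec1_succ.
have rS' := rec1_subst (recursive_nth 3 0) rec1_succ.
have rc := rec2_subst (rec2_subst rS rS rec2_mul) rS' rec2_sub.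
have r := rec2_iteri (rec1_const 0) (rec3_subst rc (recursive_nth 3 1) rS rec3_if
  : rec3 (fun i r _ => if r.+1 * r.+1 - i.+1 is 0 then r.+1 else r)).
apply: recursive_ext (rec2_subst (recursive_nth 1 0) (rec_const 1 0) r) _ => x.
apply: eq_iteri => i {}r; rewrite -mulnn -subn_eq0; by case: subn.
Qed.

Lemma rec1_fst : rec1 nfst.
Proof.
have rs := rec1_isqrt.
apply: recursive_ext
  (rec2_subst (recursive_nth 1 0) (rec2_subst rs rs rec2_mul) rec2_sub) _ => x.
by rewrite mulnn.
Qed.

Lemma rec1_snd : rec1 nsnd.
Proof. by apply: recursive_ext (rec2_subst rec1_isqrt rec1_fst rec2_sub) _. Qed.

(** * Computable functions between encoded types *)

Section UnaryClosure.
Variables f g h : nat -> nat.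
Hypotheses (rf : rec1 f) (rg : rec1 g) (rh : rec1 h).

Lemma rec1_comp : rec1 (fun n => f (g n)).
Proof. by apply: recursive_ext (rec1_subst rg rf) _. Qed.

Lemma rec1_op2 op : rec2 op -> rec1 (fun n => op (f n) (g n)).
Proof. by move=> ro; apply: recursive_ext (rec2_subst rf rg ro) _. Qed.

Lemma rec1_pair : rec1 (fun n => npair (f n) (g n)).
Proof. exact: rec1_op2 rec2_pair. Qed.

Lemma rec1_if : rec1 (fun n => if f n is 0 then h n else g n).
Proof. by apply: recursive_ext (rec3_subst rf rg rh rec3_if) _. Qed.

(** The argument n is a parameter of the iteration, paired with its state. *)
Lemma rec1_iter : rec1 (fun n => iter (f n) (fun r => h (npair r n)) (g n)).
Proof.
have rs := rec1_subst (rec2_subst (recursive_nth 3 1) (recursive_nth 3 2) rec2_pair) rh.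
have r := rec2_iteri rg (rs : rec3 (fun _ r p => h (npair r p))).
apply: recursive_ext (rec2_subst rf (recursive_nth 1 0) r) _ => x.
by elim: (f _) => //= k ->.
Qed.

End UnaryClosure.

Class encoding (T : Type) := encode : T -> nat.
#[local] Hint Mode encoding ! : typeclass_instances.

Instance nat_encoding : encoding nat := id.
Instance bool_encoding : encoding bool := nat_of_bool.
Instance prod_encoding (S T : Type) (eS : encoding S) (eT : encoding T) :
  encoding (S * T) := fun p => npair (encode p.1) (encode p.2).
Instance seq_encoding (T : Type) (eT : encoding T) : encoding (seq T) :=
  foldr (fun x c => (npair (encode x) c).+1) 0.

Definition faithful T (eT : encoding T) := injective (@encode T eT).

Lemma npair_inj x y x' y' : npair x y = npair x' y' -> x = x' /\ y = y'.
Proof.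
by move=> eq_p; split; [rewrite -(npairK1 x y) eq_p npairK1
                      | rewrite -(npairK2 x y) eq_p npairK2].
Qed.

Lemma faithful_bool : faithful bool_encoding. Proof. by do 2!case. Qed.

Lemma faithful_prod S T (eS : encoding S) (eT : encoding T) :
  faithful eS -> faithful eT -> faithful (prod_encoding eS eT).
Proof. by move=> iS iT [x y] [x' y'] /npair_inj[/iS /= -> /iT /= ->]. Qed.

Lemma faithful_seq T (eT : encoding T) : faithful eT -> faithful (seq_encoding eT).
Proof.
move=> iT; elim=> [|x s IHs] [|y t] //= [] /npair_inj[/iT -> eq_st].
by rewrite (IHs t).
Qed.

(** Nothing is required of phi on numbers that are not codes, so that encodings need
    not be surjective. *)
Definition computable S T (eS : encoding S) (eT : encoding T) (f : S -> T) :=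
  exists2 phi, rec1 phi & forall x, phi (encode x) = encode (f x).
Arguments computable {S T eS eT} f.

Section Combinators.
Context (X : Type) (eX : encoding X).
Context (S : Type) (eS : encoding S) (T : Type) (eT : encoding T).

Lemma computable_ext (f g : S -> T) : computable f -> f =1 g -> computable g.
Proof. by move=> cf /funext <-. Qed.

Lemma computable_id : computable (@id S).
Proof. by exists id => //; apply: rec1_id. Qed.

Lemma computable_const (c : T) : computable (fun _ : S => c).
Proof. by exists (fun _ => encode c) => //; apply: rec1_const. Qed.

Lemma computable_comp (g : S -> T) (f : X -> S) :
  computable g -> computable f -> computable (fun x => g (f x)).
Proof.
case=> phi rphi phiE [psi rpsi psiE].
by exists (fun n => phi (psi n)) => [|x]; [apply: rec1_comp | rewrite psiE phiE].
Qed.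

Lemma computable_pair (f : X -> S) (g : X -> T) :
  computable f -> computable g -> computable (fun x => (f x, g x)).
Proof.
case=> phi rphi phiE [psi rpsi psiE].
exists (fun n => npair (phi n) (psi n)) => [|x].
  exact: rec1_pair.
by rewrite psiE phiE.
Qed.

Lemma computable_fst (f : X -> S * T) :
  computable f -> computable (fun x => (f x).1).
Proof.
case=> phi rphi phiE; exists (fun n => nfst (phi n)) => [|x].
  exact: rec1_comp rec1_fst rphi.
by rewrite phiE npairK1.
Qed.

Lemma computable_snd (f : X -> S * T) :
  computable f -> computable (fun x => (f x).2).
Proof.
case=> phi rphi phiE; exists (fun n => nsnd (phi n)) => [|x].
  exact: rec1_comp rec1_snd rphi.
by rewrite phiE npairK2.
Qed.

Lemma computable_if (b : X -> bool) (f g : X -> S) :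
    computable b -> computable f -> computable g ->
  computable (fun x => if b x then f x else g x).
Proof.
case=> beta rb bE [phi rphi phiE] [psi rpsi psiE].
exists (fun n => if beta n is 0 then psi n else phi n) => [|x].
  exact: rec1_if.
by rewrite bE phiE psiE /encode; case: (b x).
Qed.

Lemma computable_cons (f : X -> S) (g : X -> seq S) :
  computable f -> computable g -> computable (fun x => f x :: g x).
Proof.
case=> phi rphi phiE [psi rpsi psiE].
exists (fun n => (npair (phi n) (psi n)).+1) => [|x].
  exact: rec1_comp rec1_succ (rec1_pair rphi rpsi).
by rewrite phiE psiE.
Qed.

Lemma computable_case (l : X -> seq S) (f : X -> T) (h : X -> S -> seq S -> T) :
    computable l -> computable f ->
    computable (fun p : X * (S * seq S) => h p.1 p.2.1 p.2.2) ->
  computable (fun x => if l x is a :: l' then h x a l' else f x).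
Proof.
case=> lam rlam lamE [phi rphi phiE] [eta reta etaE].
exists (fun n => if lam n is 0 then phi n else eta (npair n (lam n).-1)) => [|x].
  apply: rec1_if => //; apply: rec1_comp reta _.
  exact: rec1_pair rec1_id (rec1_comp rec1_pred rlam).
rewrite lamE; case: (l x) => [|a l'] /=; first by rewrite phiE.
by rewrite (etaE (x, (a, l'))).
Qed.

Lemma leq_size_code (l : seq S) : size l <= encode l.
Proof.
elim: l => //= a l IHl; rewrite ltnS.
exact: leq_trans IHl (leq_npair _ _).
Qed.

Lemma computable_foldl (l : X -> seq S) (f : X -> T) (h : X -> T -> S -> T) :
    computable l -> computable f ->
    computable (fun p : X * (T * S) => h p.1 p.2.1 p.2.2) ->
  computable (fun x => foldl (h x) (f x) (l x)).
Proof.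
case=> lam rlam lamE [phi rphi phiE] [eta reta etaE].
(* A state pairs the code of the rest of the list with the accumulator. *)
pose step q := let r := nfst q in
  if nfst r is 0 then r else
  npair (nsnd (nfst r).-1)
        (eta (npair (nsnd q) (npair (nsnd r) (nfst (nfst r).-1)))).
have rstep : rec1 step.
  have r1 := rec1_fst; have r2 := rec1_snd.
  have r11 := rec1_comp r1 r1; have r21 := rec1_comp r2 r1.
  have r11p := rec1_comp rec1_pred r11.
  apply: (rec1_if r11 _ r1).
  apply: (rec1_pair (rec1_comp r2 r11p)); apply: (rec1_comp reta).
  exact: rec1_pair r2 (rec1_pair r21 (rec1_comp r1 r11p)).
exists (fun n => nsnd (iter (lam n) (fun r => step (npair r n))
                            (npair (lam n) (phi n)))) => [|x].
  apply: rec1_comp rec1_snd _.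
  exact: rec1_iter rlam (rec1_pair rlam rphi) rstep.
rewrite lamE phiE.
suff foldE (k : nat) (s : seq S) (y : T) : size s <= k ->
    nsnd (iter k (fun r => step (npair r (@encode _ eX x)))
                 (npair (@encode _ (seq_encoding eS) s) (@encode _ eT y)))
    = @encode _ eT (foldl (h x) y s).
  exact: foldE (leq_size_code _).
elim: k s y => [|k IHk] [|a s] y // le_sk; first exact: npairK2.
  rewrite iterSr (_ : step _ = npair (@encode _ (seq_encoding eS) nil) (@encode _ eT y)) ?IHk //.
  by rewrite /step !npairK1.
rewrite iterSr (_ : step _ = npair (@encode _ (seq_encoding eS) s)
                                   (@encode _ eT (h x y a))) ?IHk //.
by rewrite /step !(npairK1, npairK2, succnK) (etaE (x, (y, a))).
Qed.

End Combinators.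

(* Solves computability goals for constants and nested projections. *)
Ltac comp_var :=
  first [ exact: computable_id | exact: computable_const
        | apply: computable_fst; comp_var | apply: computable_snd; comp_var ].

Section Functions.
Context (X : Type) (eX : encoding X).
Context (S : Type) (eS : encoding S) (T : Type) (eT : encoding T).

Lemma computable_rec1 (f : nat -> nat) (g : X -> nat) :
  rec1 f -> computable g -> computable (fun x => f (g x)).
Proof.
by move=> rf; apply: (@computable_comp _ _ nat _ nat _ f); exists f.
Qed.

Lemma computable_rec2 (op : nat -> nat -> nat) (f g : X -> nat) :
  rec2 op -> computable f -> computable g ->
  computable (fun x => op (f x) (g x)).
Proof.
move=> rop [phi rphi phiE] [psi rpsi psiE].
exists (fun n => op (phi n) (psi n)); first exact: rec1_op2.
by move=> x; rewrite phiE psiE.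
Qed.

Lemma computable_add (f g : X -> nat) :
  computable f -> computable g -> computable (fun x => f x + g x).
Proof. exact: computable_rec2 rec2_add. Qed.

Lemma computable_mul (f g : X -> nat) :
  computable f -> computable g -> computable (fun x => f x * g x).
Proof. exact: computable_rec2 rec2_mul. Qed.

Lemma computable_succ (f : X -> nat) :
  computable f -> computable (fun x => (f x).+1).
Proof. exact: computable_rec1 rec1_succ. Qed.

Lemma computable_comp2 U (eU : encoding U) (h : S -> T -> U) f g :
    computable (fun p : S * T => h p.1 p.2) -> computable f -> computable g ->
  computable (fun x : X => h (f x) (g x)).
Proof.
move=> ch cf cg.
exact: (computable_comp (f := fun x => (f x, g x)) ch (computable_pair cf cg)).
Qed.

Lemma computable_not (b : X -> bool) :
  computable b -> computable (fun x => ~~ b x).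
Proof.
move=> cb; apply: (computable_ext (f := fun x => if b x then false else true)).
  exact: computable_if cb (computable_const _ _ _) (computable_const _ _ _).
by move=> x; case: (b x).
Qed.

Lemma computable_eq (f g : X -> nat) :
  computable f -> computable g -> computable (fun x => f x == g x).
Proof.
case=> phi rphi phiE [psi rpsi psiE].
pose d n := (phi n - psi n) + (psi n - phi n).
have rd : rec1 d.
  by apply: rec1_op2 rec2_add; apply: rec1_op2 rec2_sub.
have dE a b : (if (a - b) + (b - a) is 0 then 1 else 0) = (a == b) :> nat.
  case: eqP => [->|]; first by rewrite subnn.
  by case E: (a - b + (b - a)); lia.
exists (fun n => if d n is 0 then 1 else 0) => [|x].
  exact: rec1_if rd (rec1_const 0) (rec1_const 1).
by rewrite /d phiE psiE dE.
Qed.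

Lemma computable_iter (n : X -> nat) (f : X -> S) (h : X -> S -> S) :
    computable n -> computable f -> computable (fun p : X * S => h p.1 p.2) ->
  computable (fun x => iter (n x) (h x) (f x)).
Proof.
case=> nu rnu nuE [phi rphi phiE] [eta reta etaE].
exists (fun k => iter (nu k) (fun r => eta (npair k r)) (phi k)) => [|x].
  have rh := rec1_comp reta (rec1_pair rec1_snd rec1_fst).
  apply: recursive_ext (rec1_iter rnu rphi rh) _ => k; apply: eq_iter => r.
  by rewrite npairK1 npairK2.
rewrite nuE phiE; elim: (n x : nat) => //= k ->.
exact: (etaE (x, _)).
Qed.

Lemma computable_rev (l : X -> seq S) :
  computable l -> computable (fun x => rev (l x)).
Proof.
move=> cl; apply: (computable_ext (f := fun x => foldl (fun y a => a :: y) nil (l x))).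
  apply: (computable_foldl (h := fun _ y a => a :: y)) cl (computable_const _ _ _) _.
  apply: computable_cons; first by comp_var.
  by comp_var.
by move=> x; rewrite /rev; elim: (l x) nil => //= a s IHs t; rewrite IHs.
Qed.

Lemma computable_foldr (l : X -> seq S) (f : X -> T) (h : X -> S -> T -> T) :
    computable l -> computable f ->
    computable (fun p : X * (T * S) => h p.1 p.2.2 p.2.1) ->
  computable (fun x => foldr (h x) (f x) (l x)).
Proof.
move=> cl cf ch.
apply: (computable_ext (f := fun x => foldl (fun y a => h x a y) (f x) (rev (l x)))).
  exact: (computable_foldl (h := fun x y a => h x a y)) (computable_rev cl) cf ch.
by move=> x; rewrite foldl_rev.
Qed.

End Functions.

Section Lists.
Context (X : Type) (eX : encoding X).
Context (S : Type) (eS : encoding S) (T : Type) (eT : encoding T).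

Lemma computable_cat (l m : X -> seq S) :
  computable l -> computable m -> computable (fun x => l x ++ m x).
Proof.
move=> cl cm; apply: (computable_ext (f := fun x => foldr cons (m x) (l x))).
  apply: (computable_foldr (h := fun _ => cons)) cl cm _.
  apply: computable_cons; first by comp_var.
  by comp_var.
by move=> x; elim: (l x) => //= a s ->.
Qed.

Lemma computable_map (l : X -> seq S) (h : X -> S -> T) :
    computable l -> computable (fun p : X * S => h p.1 p.2) ->
  computable (fun x => map (h x) (l x)).
Proof.
move=> cl ch.
apply: (computable_ext (f := fun x => foldr (fun a => cons (h x a)) nil (l x))).
  apply: (computable_foldr (h := fun x a => cons (h x a))) cl _ _.
    exact: computable_const.
  apply: computable_cons; last by comp_var.
  apply: (computable_comp2 ch); first by comp_var.
  by comp_var.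
by move=> x; elim: (l x) => //= a s ->.
Qed.

End Lists.

Section MoreLists.
Context (X : Type) (eX : encoding X).
Context (S : Type) (eS : encoding S) (T : Type) (eT : encoding T).

Lemma computable_flatten (l : X -> seq (seq S)) :
  computable l -> computable (fun x => flatten (l x)).
Proof.
move=> cl; apply: (computable_foldr (h := fun _ => cat)) cl (computable_const _ _ _) _.
apply: computable_cat; first by comp_var.
by comp_var.
Qed.

Lemma computable_filter (l : X -> seq S) (b : X -> S -> bool) :
    computable l -> computable (fun p : X * S => b p.1 p.2) ->
  computable (fun x => filter (b x) (l x)).
Proof.
move=> cl cb.
apply: (computable_ext (f := fun x =>
  foldr (fun a r => if b x a then a :: r else r) nil (l x))).
  apply: (computable_foldr (h := fun x a r => if b x a then a :: r else r)) => //.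
    exact: computable_const.
  apply: computable_if; last by comp_var.
    by apply: (computable_comp2 cb); comp_var.
  by apply: computable_cons; comp_var.
by move=> x; elim: (l x) => //= a s ->.
Qed.

Lemma computable_size (l : X -> seq S) :
  computable l -> computable (fun x => size (l x)).
Proof.
move=> cl; apply: (computable_ext (f := fun x => foldr (fun _ => succn) 0 (l x))).
  apply: (computable_foldr (h := fun _ _ => succn)) cl (computable_const _ _ _) _.
  by apply: computable_succ; comp_var.
by move=> x; elim: (l x) => //= a s ->.
Qed.

Lemma computable_has (l : X -> seq S) (b : X -> S -> bool) :
    computable l -> computable (fun p : X * S => b p.1 p.2) ->
  computable (fun x => has (b x) (l x)).
Proof.
move=> cl cb; apply: (computable_ext (f := fun x => size (filter (b x) (l x)) != 0)).
  apply: computable_not; apply: computable_eq (computable_const _ _ _).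
  exact: computable_size (computable_filter cl cb).
by move=> x; elim: (l x) => //= a s; case: (b x a).
Qed.

Lemma computable_equal (f g : X -> S) : faithful eS ->
  computable f -> computable g -> forall b : X -> bool, (forall x, reflect (f x = g x) (b x)) ->
  computable b.
Proof.
move=> iS [phi rphi phiE] [psi rpsi psiE] b bP.
have c : computable (fun x : X => phi (@encode _ eX x) == psi (@encode _ eX x)).
  by apply: computable_eq; [exists phi | exists psi].
apply: (computable_ext c) => x; rewrite phiE psiE.
by apply/eqP/bP => [/iS | ->].
Qed.

End MoreLists.

Lemma computable_nseq X (eX : encoding X) S (eS : encoding S)
    (n : X -> nat) (f : X -> S) :
  computable n -> computable f -> computable (fun x => nseq (n x) (f x)).
Proof.
move=> cn cf; apply: (computable_iter (h := fun x => cons (f x))) cn _ _.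
  exact: computable_const.
apply: computable_cons; last exact: computable_snd (computable_id _).
exact: computable_comp cf (computable_fst (computable_id _)).
Qed.

(** The size of the list built so far is its next element. *)
Lemma computable_iota X (eX : encoding X) (n : X -> nat) :
  computable n -> computable (fun x => iota 0 (n x)).
Proof.
move=> cn; pose step (_ : X) (s : seq nat) := rcons s (size s).
apply: (computable_ext (f := fun x => iter (n x) (step x) nil)).
  apply: computable_iter cn (computable_const _ _ _) _.
  apply: (computable_ext (f := fun p : X * seq nat => p.2 ++ [:: size p.2])).
    apply: computable_cat; first by comp_var.
    by apply: computable_cons; [apply: computable_size; comp_var | comp_var].
  by move=> p; rewrite /step cats1.
move=> x; elim: (n x) => //= k ->.
by rewrite /step size_iota -cats1 -(iotaD 0 k 1) addn1.
Qed.

(** Such a function is a finite table of values. *)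
Lemma computable_table (A : finType) (eA : encoding A) (T : Type)
    (eT : encoding T) (f : A -> T) :
  faithful eA -> computable f.
Proof.
move=> iA.
pose cA := @encode A eA; pose cT := @encode T eT.
pose phi (s : seq A) (n : nat) :=
  foldr (fun x r => if n == cA x then cT (f x) else r) 0 s.
exists (phi (enum A)) => [|x].
  elim: (enum A) => [|a s IHs]; first exact: rec1_const.
  have c : computable (fun n : nat => if n == cA a then cT (f a) else phi s n).
    apply: computable_if; last by exists (phi s).
      exact: computable_eq (computable_id _) (computable_const _ _ _).
    exact: computable_const.
  case: c => psi rpsi psiE; apply: recursive_ext rpsi _ => y; exact: psiE.
have: x \in enum A by rewrite mem_enum.
elim: (enum A) => //= a s IHs; rewrite in_cons.
case: (eqVneq x a) => [-> | ne_xa /= /IHs]; first by rewrite eqxx.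
by case: eqP => // /iA eq_xa; rewrite eq_xa eqxx in ne_xa.
Qed.

Lemma computable_divmod k (f : nat -> nat) : computable f ->
  computable (fun n => (f n %/ k, f n %% k)).
Proof.
move=> cf; pose step (_ : nat) (p : nat * nat) :=
  if p.2.+1 == k then (p.1.+1, 0) else (p.1, p.2.+1).
case: k @step => [|k] step.
  apply: (computable_ext (f := fun n => (0, f n))).
    exact: computable_pair (computable_const _ _ _) cf.
  by move=> n; rewrite divn0 modn0.
apply: (computable_ext (f := fun n => iter (f n) (step n) (0, 0))).
  apply: computable_iter cf (computable_const _ _ _) _.
  apply: computable_if.
  - by apply: computable_eq; [apply: computable_succ|]; comp_var.
  - by apply: computable_pair; [apply: computable_succ|]; comp_var.
  by apply: computable_pair; [|apply: computable_succ]; comp_var.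
move=> n; elim: (f n) => [|m /= ->]; first by rewrite /= div0n mod0n.
rewrite /step /=; have := ltn_pmod m (ltn0Sn k); have := divn_eq m k.+1.
move: (m %/ k.+1) (m %% k.+1) => q r -> lt_r.
case: eqP => [[->] | ne_r]; [rewrite -addnS -mulSnr | rewrite -addnS].
  by rewrite mulnK // modnMl.
have lt_r1 : r.+1 < k.+1 by lia.
by rewrite divnMDl // modnMDl modn_small // divn_small // addn0.
Qed.

(** The digits 1, ..., k of bijective numeration in base k are shifted to 0, ..., k - 1. *)
Definition digits k c : seq nat :=
  rev (iter c (fun p : nat * seq nat => if p.1 is 0 then p else
                 (p.1.-1 %/ k, p.1.-1 %% k :: p.2)) (c, nil)).2.

Lemma computable_digits k : computable (digits k).
Proof.
apply: computable_rev; apply: computable_snd.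
pose step (_ : nat) (p : nat * seq nat) := if p.1 == 0 then p else
  let d := (p.1.-1 %/ k, p.1.-1 %% k) in (d.1, d.2 :: p.2).
apply: (computable_ext (f := fun n => iter n (step n) (n, nil))).
  apply: computable_iter; first by comp_var.
    exact: computable_pair (computable_id _) (computable_const _ _ _).
  have cd : computable (fun p : nat * (nat * seq nat) =>
      (p.2.1.-1 %/ k, p.2.1.-1 %% k)).
    apply: (computable_comp (g := fun d => (d %/ k, d %% k))
                            (f := fun p : nat * (nat * seq nat) => p.2.1.-1)).
      exact: computable_divmod (computable_id _).
    by apply: computable_rec1 rec1_pred _; comp_var.
  apply: computable_if; [|by comp_var|].
    by apply: computable_eq; comp_var.
  apply: computable_pair (computable_fst cd) (computable_cons (computable_snd cd) _).
  by comp_var.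
by move=> n; apply: eq_iter => -[[|c] s].
Qed.

Lemma digits_word_code (A : finType) (w : seq A) :
  digits #|A| (word_code w) = [seq nat_of_ord (enum_rank x) | x <- w].
Proof.
rewrite /digits; set step := (fun p : nat * seq nat => _).
suff stepE n s : size w <= n ->
    (iter n step (word_code w, s)).2 = catrev [seq nat_of_ord (enum_rank x) | x <- w] s.
  rewrite stepE ?revK //; elim: w {stepE} => //= x w IHw.
  apply: leq_ltn_trans IHw _; rewrite ltnS.
  by apply: leq_trans (leq_addl _ _); rewrite leq_pmull // (leq_trans _ (ltn_ord (enum_rank x))).
elim: w n s => [|x w IHw] [|n] s //= le_wn; first by rewrite (iter_fix n).
rewrite -[step _]iterS iterSr [step (_, _)]/step /=.
have lt_x := ltn_ord (enum_rank x).
rewrite addnC [_ * word_code w]mulnC divnMDl ?(leq_trans _ lt_x) //.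
by rewrite divn_small // addn0 modnMDl modn_small // IHw.
Qed.

(** The number of a word is first converted to the list of its digits, and the digits
    to codes of letters by a finite table. *)
Lemma decidable_language_computable (A : finType) (eA : encoding A)
    (L : set (seq A)) (b : seq A -> bool) :
  computable b -> (forall w, reflect (L w) (b w)) -> decidable_language L.
Proof.
case=> beta rbeta betaE bP; pose cA := @encode A eA.
pose t := [seq cA x | x <- enum A].
have [delta rdelta deltaE] :
    computable (fun c : nat => [seq nth 0 t d | d <- digits #|A| c]).
  apply: computable_map; first exact: computable_digits.
  apply: (computable_comp (g := nth 0 t)); last by comp_var.
  exists (nth 0 t) => //; elim: t => [|a t IHt].
    by apply: recursive_ext (rec1_const 0) _ => x; rewrite nth_nil.
  have rt := rec1_comp IHt rec1_pred.
  apply: recursive_ext (rec1_if rec1_id rt (rec1_const a)) _ => x.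
  by case: (nth 0 x 0).
exists (fun x : 1.-tuple nat => beta (delta (nth 0 x 0))) => [|w].
  exact: rec1_comp rbeta rdelta.
have -> : delta (nth 0 [tuple word_code w] 0) = @encode _ (seq_encoding eA) w.
  rewrite (deltaE (word_code w)) digits_word_code -map_comp.
  have -> : [seq (nth 0 t \o (fun x => nat_of_ord (enum_rank x))) i | i <- w] = map cA w.
    apply: eq_map => x /=; rewrite (nth_map x) -?cardE //.
    by rewrite -[in RHS](enum_rankK x) /enum_val (set_nth_default x) // -cardE.
  by elim: w => //= x w; rewrite /encode /= => ->.
by rewrite betaE; congr nat_of_bool; symmetry; apply/asboolP/bP.
Qed.

(** * Free reduction and the free group *)

Section FreeReduction.
Variable B : choiceType.
Implicit Types (x y : B * bool) (u v w : word B).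

Definition letter_inv x : B * bool := (x.1, ~~ x.2).

Definition reduce_cons x w : word B :=
  if w is y :: w' then if y == letter_inv x then w' else x :: w else [:: x].

Definition reduce : word B -> word B := foldr reduce_cons [::].

Definition reduced : pred (word B) := sorted (fun x y => y != letter_inv x).

Lemma letter_invK : involutive letter_inv.
Proof. by case=> b e; rewrite /letter_inv /= negbK. Qed.

Lemma letter_inv_neq x : letter_inv x != x.
Proof. by case: x => b []; rewrite /letter_inv xpair_eqE eqxx. Qed.

Lemma reduced_behead x w : reduced (x :: w) -> reduced w.
Proof. by case: w => //= y w /andP[]. Qed.

Lemma reduce_cons_reduced x w : reduced w -> reduced (reduce_cons x w).
Proof.
case: w => //= y w red_w; case: ifP => [_ | ne_yx]; first exact: reduced_behead red_w.
by rewrite /= ne_yx.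
Qed.

Lemma reduce_reduced w : reduced (reduce w).
Proof. by elim: w => //= x w; apply: reduce_cons_reduced. Qed.

Lemma reduce_cons_id x w : reduced (x :: w) -> reduce_cons x w = x :: w.
Proof. by case: w => //= y w /andP[/negPf->]. Qed.

Lemma reduce_id w : reduced w -> reduce w = w.
Proof.
elim: w => //= x w IHw red_xw.
by rewrite IHw ?reduce_cons_id //; apply: reduced_behead red_xw.
Qed.

Lemma reduce_consK x w : reduced w -> reduce_cons x (reduce_cons (letter_inv x) w) = w.
Proof.
case: w => [|y w] red_yw /=; first by rewrite eqxx.
rewrite letter_invK; case: eqP => [eq_yx | ne_yx] /=; last by rewrite eqxx.
by rewrite -{1}eq_yx reduce_cons_id // -eq_yx.
Qed.

Lemma foldr_reduce_reduced u w : reduced w -> reduced (foldr reduce_cons w u).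
Proof. by move=> red_w; elim: u => //= x u; apply: reduce_cons_reduced. Qed.

Lemma foldr_reduce u w : reduced w ->
  foldr reduce_cons w (reduce u) = foldr reduce_cons w u.
Proof.
move=> red_w; elim: u => //= x u <-; case: (reduce u) => //= y v.
case: eqP => //= ->; rewrite reduce_consK //; exact: foldr_reduce_reduced.
Qed.

Lemma reduce_cat u v : reduce (u ++ v) = foldr reduce_cons (reduce v) u.
Proof. exact: foldr_cat. Qed.

Lemma reduce_catl u v : reduce (reduce u ++ v) = reduce (u ++ v).
Proof. by rewrite !reduce_cat foldr_reduce // reduce_reduced. Qed.

Lemma reduce_catr u v : reduce (u ++ reduce v) = reduce (u ++ v).
Proof. by rewrite !reduce_cat (reduce_id (reduce_reduced v)). Qed.

Lemma word_inv_cons x w : word_inv (x :: w) = rcons (word_inv w) (letter_inv x).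
Proof. exact: rev_cons. Qed.

Lemma reduce_mulV w : reduce (w ++ word_inv w) = [::].
Proof.
elim: w => //= x w IHw; rewrite word_inv_cons -cats1 catA -reduce_catl IHw /=.
by rewrite eqxx.
Qed.

Lemma reduce_mulVl w : reduce (word_inv w ++ w) = [::].
Proof. by rewrite -{2}(word_invK w) reduce_mulV. Qed.

Lemma size_reduce w : size (reduce w) <= size w.
Proof.
elim: w => //= x w; case: (reduce w) => //= y v le_vw.
by case: ifP => //= _; lia.
Qed.

Lemma reduce_sub w : {subset reduce w <= w}.
Proof.
elim: w => //= x w IHw y; rewrite [y \in x :: w]in_cons.
case: (reduce w) IHw => [|z v] IHw /=; first by rewrite inE => ->.
case: ifP => _; rewrite ?in_cons => y_in; first by rewrite IHw ?orbT // in_cons y_in orbT.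
by case/orP: y_in => [-> // | y_zv]; rewrite IHw ?orbT // in_cons.
Qed.

Lemma word_equiv_reduce (R : set (word B)) w : word_equiv R (reduce w) w.
Proof.
elim: w => [|x w IHw]; first exact: we_refl.
have red_cons v : word_equiv R (reduce_cons x v) (x :: v).
  case: v => [|y v] /=; first exact: we_refl.
  case: eqP => [-> | _]; last exact: we_refl.
  apply: we_sym; apply: (@we_cat _ R [:: x; letter_inv x] nil v v); last exact: we_refl.
  by case: x {IHw}; apply: we_cancel.
apply: we_trans (red_cons _) _.
by apply: (@we_cat _ R [:: x] [:: x]); first exact: we_refl.
Qed.

(** Free cancellations are allowed in every presentation. *)
Lemma word_equiv_of_reduce (R : set (word B)) u v :
  reduce u = reduce v -> word_equiv R u v.
Proof.
move=> eq_uv; apply: we_trans (word_equiv_reduce R v).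
by rewrite -eq_uv; apply/we_sym/word_equiv_reduce.
Qed.

(** Reduced words, rather than classes of words, represent the elements, so that
    algorithms can handle them. *)
Record free_group := FreeElt { free_val : word B; free_valP : reduced free_val }.

HB.instance Definition _ := [isSub for free_val].
HB.instance Definition _ := [Choice of free_group by <:].

Definition free_of w := FreeElt (reduce_reduced w).

Definition free_mul (f h : free_group) := free_of (free_val f ++ free_val h).
Definition free_inv (f : free_group) := free_of (word_inv (free_val f)).

Lemma free_of_val f : free_of (free_val f) = f.
Proof. by apply: val_inj; rewrite /= reduce_id // free_valP. Qed.

Lemma free_mul_of u v : free_mul (free_of u) (free_of v) = free_of (u ++ v).
Proof. by apply: val_inj; rewrite /= reduce_catl reduce_catr. Qed.

Lemma free_mulA : associative free_mul.
Proof.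
move=> f g h; rewrite -[f]free_of_val -[g]free_of_val -[h]free_of_val.
by rewrite !free_mul_of catA.
Qed.

Lemma free_mul1 : left_id (free_of [::]) free_mul.
Proof. by move=> f; rewrite -[f]free_of_val free_mul_of. Qed.

Lemma free_mulr1 : right_id (free_of [::]) free_mul.
Proof. by move=> f; rewrite -[f]free_of_val free_mul_of cats0. Qed.

Lemma free_mulV : left_inverse (free_of [::]) free_inv free_mul.
Proof.
move=> f; apply: val_inj; rewrite /= reduce_catl.
by rewrite reduce_mulVl.
Qed.

Lemma free_mulrV : right_inverse (free_of [::]) free_inv free_mul.
Proof.
move=> f; apply: val_inj; rewrite /= reduce_catr.
by rewrite reduce_mulV.
Qed.

HB.instance Definition _ := isGroup.Build free_group
  free_mulA free_mul1 free_mulr1 free_mulV free_mulrV.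

End FreeReduction.

Section FreeGroup.
Variable B : choiceType.
Local Open Scope group_scope.
Implicit Types (u v w : word B) (f h : free_group B).

Lemma free_of_cat u v : free_of (u ++ v) = free_of u * free_of v.
Proof. by rewrite -free_mul_of. Qed.

Lemma free_of_nil : free_of (@nil (B * bool)) = 1.
Proof. by []. Qed.

Lemma free_of_inv u : free_of (word_inv u) = (free_of u)^-1.
Proof.
by apply: (mulgI (free_of u)); rewrite mulgV -free_of_cat; apply: val_inj; apply: reduce_mulV.
Qed.

Lemma free_ofP u v : reflect (reduce u = reduce v) (free_of u == free_of v).
Proof. by apply: (iffP eqP) => [[] | eq_uv] //; apply: val_inj. Qed.

Lemma size_free_mul f h : size (free_val (f * h)) <= size (free_val f) + size (free_val h).
Proof. by rewrite -size_cat; apply: size_reduce. Qed.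

End FreeGroup.

(** * Bounded products in a free group *)

Lemma cat_eq_cat_cons (T : Type) (s t a b : seq T) x : s ++ t = a ++ x :: b ->
  (exists2 c, s = a ++ x :: c & b = c ++ t) \/
  (exists2 c, a = s ++ c & t = c ++ x :: b).
Proof.
elim: s a => [|y s IHs] [|z a] /=; first by right; exists [::].
- by move=> ->; right; exists (z :: a).
- by case=> -> <-; left; exists s.
case=> -> st_eq; case: (IHs _ st_eq) => [[c -> ->] | [c -> ->]]; first by left; exists c.
by right; exists c.
Qed.

Lemma flatten_eq_cat_cons (T : Type) (ss : seq (seq T)) a x b :
    flatten ss = a ++ x :: b ->
  exists ss1 s1 s2 ss2, [/\ ss = ss1 ++ (s1 ++ x :: s2) :: ss2,
    a = flatten ss1 ++ s1 & b = s2 ++ flatten ss2].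
Proof.
elim: ss a => [|s ss IHss] a /= ss_eq; first by case: a ss_eq.
case: (cat_eq_cat_cons ss_eq) => [[c -> ->] | [c -> /IHss[ss1 [s1 [s2 [ss2 [-> -> ->]]]]]]].
  by exists [::], a, c, ss.
by exists (s :: ss1), s1, s2, ss2; rewrite /= catA.
Qed.

Section BoundedProducts.
Variables (B : choiceType) (Q : seq (word B)).
Implicit Types (u v w s p : word B) (ws : seq (word B)).

Definition product_of (f : free_group B) :=
  exists2 ws, {subset ws <= Q} & f = free_of (flatten ws).

(** The first letter of the reduced word comes from a letter of w, and what precedes
    this letter in w has cancelled. *)
Lemma reduce_eq_cons w x u : reduce w = x :: u ->
  exists w0 w1, [/\ w = w0 ++ x :: w1, reduce w0 = [::] & reduce w1 = u].
Proof.
have [n] := ubnP (size w); elim: n w x u => // n IHn [|y w] x u //=.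
rewrite ltnS => lt_wn; case red_w: (reduce w) => [|z v] /=.
  by case=> <- <-; exists [::], w.
case: eqP => [eq_z eq_v | _ [<- <-]]; last by exists [::], w.
have [a [b [w_eq red_a red_b]]] := IHn _ _ _ lt_wn red_w.
rewrite eq_v in red_b.
have lt_bn : size b < n by move: lt_wn; rewrite w_eq size_cat /=; lia.
have [c [d [b_eq red_c red_d]]] := IHn _ _ _ lt_bn red_b.
exists (y :: a ++ z :: c), d; split => //; first by rewrite w_eq b_eq /= -catA.
rewrite /= -reduce_catl red_a /= red_c /= eq_z.
by rewrite eqxx.
Qed.

Definition suffixes := [::] :: [seq drop i q | q <- Q, i <- iota 0 (size q).+1].
Definition prefixes := [::] :: [seq take i q | q <- Q, i <- iota 0 (size q).+1].

Lemma mem_suffixes p s : p ++ s \in Q -> s \in suffixes.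
Proof.
move=> Qps; rewrite in_cons; apply/orP; right; apply/allpairsPdep.
exists (p ++ s), (size p); split=> //; last by rewrite drop_size_cat.
by rewrite mem_iota size_cat; lia.
Qed.

Lemma mem_prefixes p s : p ++ s \in Q -> p \in prefixes.
Proof.
move=> Qps; rewrite in_cons; apply/orP; right; apply/allpairsPdep.
exists (p ++ s), (size p); split=> //; last by rewrite take_size_cat.
by rewrite mem_iota size_cat; lia.
Qed.

Lemma suffixes_cat p s : p ++ s \in suffixes -> s \in suffixes.
Proof.
rewrite in_cons => /predU1P[|].
  by case: p => //= ->; rewrite inE.
case/allpairsPdep=> q [i [Qq _ ps_eq]].
by apply: (@mem_suffixes (take i q ++ p)); rewrite -catA ps_eq cat_take_drop.
Qed.

(** There are only finitely many pairs (s, p), and one ws' can be fixed for each. *)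
Lemma bounded_gap : exists C, forall s p, s \in suffixes -> p \in prefixes ->
  forall ws, {subset ws <= Q} -> reduce (s ++ flatten ws ++ p) = [::] ->
  exists ws', [/\ {subset ws' <= Q}, reduce (s ++ flatten ws' ++ p) = [::]
                & size ws' <= C].
Proof.
suff bounded (l : seq (word B * word B)) : exists C, forall sp, sp \in l ->
    forall ws, {subset ws <= Q} -> reduce (sp.1 ++ flatten ws ++ sp.2) = [::] ->
    exists ws', [/\ {subset ws' <= Q}, reduce (sp.1 ++ flatten ws' ++ sp.2) = [::]
                  & size ws' <= C].
  have [C bC] := bounded [seq (s, p) | s <- suffixes, p <- prefixes].
  exists C => s p s_in p_in; apply: (bC (s, p)).
  by apply/allpairsP; exists (s, p).
elim: l => [|sp l [C IHl]]; first by exists 0.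
have [[ws0 Qws0 red_ws0] | no_ws] := pselect (exists2 ws, {subset ws <= Q} &
    reduce (sp.1 ++ flatten ws ++ sp.2) = [::]); last first.
  exists C => sp'; rewrite in_cons => /predU1P[-> ws Qws red_ws | /IHl //].
  by case: no_ws; exists ws.
exists (maxn C (size ws0)) => sp'; rewrite in_cons => /predU1P[-> | /IHl bC] ws Qws red_ws.
  by exists ws0; split; rewrite ?leq_maxr.
have [ws' [Qws' red_ws' le_ws']] := bC _ Qws red_ws.
by exists ws'; split=> //; rewrite leq_max le_ws'.
Qed.

(** Benois' argument: in a product of generators that reduces to x_1 ... x_n, the
    letters x_i are separated by factors that reduce to the empty word. Such a
    factor runs from some position in a generator to some position in another
    one. There are finitely many such pairs of positions, and the factor can be
    replaced by one that is fixed for the pair. *)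
Lemma bounded_product : exists C, forall f, product_of f ->
  exists ws, [/\ {subset ws <= Q}, f = free_of (flatten ws)
               & size ws <= C * (size (free_val f)).+1].
Proof.
have [C bC] := bounded_gap; exists C.+1 => f [ws Qws f_eq].
suff bound u s : s \in suffixes -> forall ws, {subset ws <= Q} ->
    reduce (s ++ flatten ws) = u ->
    exists ws', [/\ {subset ws' <= Q}, reduce (s ++ flatten ws') = u
                  & size ws' <= C + C.+1 * size u].
  have [||ws' [Qws' red_ws' le_ws']] := bound (free_val f) [::] _ _ Qws.
  - exact: mem_head.
  - by rewrite f_eq.
  - exists ws'; split=> //; first by apply: val_inj; rewrite /= -red_ws'.
    by rewrite mulnS; lia.
elim: u s => [|x u IHu] s s_in {f_eq}ws {}Qws red_ws.
  have := bC s [::] s_in (mem_head _ _) ws Qws; rewrite !cats0.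
  case/(_ red_ws) => ws'; rewrite cats0 muln0 addn0 => bws'.
  by exists ws'.
have [w0 [w1 [ws_eq red_w0 red_w1]]] := reduce_eq_cons red_ws.
have red_xu : reduced (x :: u) by rewrite -red_ws reduce_reduced.
have red_after v : reduce v = u -> reduce (w0 ++ x :: v) = x :: u.
  by move=> red_v; rewrite -reduce_catl red_w0 /= red_v reduce_cons_id.
case: (cat_eq_cat_cons ws_eq) => [[s' s_eq w1_eq] | [w0' w0_eq {}ws_eq]].
  have s'_in : s' \in suffixes by apply: (@suffixes_cat (rcons w0 x)); rewrite cat_rcons -s_eq.
  rewrite w1_eq in red_w1; have [ws' [Qws' red_ws' le_ws']] := IHu _ s'_in _ Qws red_w1.
  exists ws'; split=> //; last by rewrite /=; lia.
  by rewrite s_eq -catA /= red_after.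
have [ws1 [q1 [q2 [ws2 [ws_eq' w0'_eq w1_eq]]]]] := flatten_eq_cat_cons ws_eq.
have Qq : q1 ++ x :: q2 \in Q by apply: Qws; rewrite ws_eq' mem_cat mem_head orbT.
have Qws1 : {subset ws1 <= Q} by move=> q q_in; apply: Qws; rewrite ws_eq' mem_cat q_in.
have Qws2 : {subset ws2 <= Q}.
  by move=> q q_in; apply: Qws; rewrite ws_eq' mem_cat in_cons q_in !orbT.
have q2_in : q2 \in suffixes by apply: (@mem_suffixes (rcons q1 x)); rewrite cat_rcons.
rewrite w1_eq in red_w1; have [ws2' [Qws2' red_ws2' le_ws2']] := IHu _ q2_in _ Qws2 red_w1.
rewrite w0_eq w0'_eq in red_w0.
have [ws1' [Qws1' red_ws1' le_ws1']] := bC s q1 s_in (mem_prefixes Qq) ws1 Qws1 red_w0.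
exists (ws1' ++ (q1 ++ x :: q2) :: ws2'); split.
- by move=> q; rewrite mem_cat in_cons => /or3P[/Qws1' | /eqP-> | /Qws2'].
- rewrite flatten_cat /= -!catA (catA _ q1) catA -reduce_catl red_ws1' /=.
  by rewrite red_ws2' reduce_cons_id.
by rewrite size_cat /= mulnS; lia.
Qed.

End BoundedProducts.

(** * Normal forms in an amalgam along an infinite cyclic subgroup *)

Local Open Scope group_scope.

Section IntegerPowers.
Variable H : groupType.
Implicit Types (x : H) (m n : int).

Definition zpow x n : H :=
  match n with Posz k => x ^+ k | Negz k => (x ^+ k.+1)^-1 end.

Lemma zpowS x n : zpow x (n + 1)%R = x * zpow x n.
Proof.
case: n => [k | [|k]].
- by rewrite (_ : (Posz k + 1)%R = Posz k.+1) /= ?expgS; last lia.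
- by rewrite (_ : (Negz 0 + 1)%R = Posz 0) /= ?expg1 ?expg0 ?mulgV; last lia.
rewrite (_ : (Negz k.+1 + 1)%R = Negz k) /=; last lia.
by rewrite [in RHS]expgSr invgM mulgA mulgV mul1g.
Qed.

Lemma zpowD x m n : zpow x (m + n)%R = zpow x m * zpow x n.
Proof.
elim/int_rect: m => [|m IHm|m IHm].
- by rewrite (_ : (0 + n)%R = n) /= ?expg0 ?mul1g; last lia.
- rewrite (_ : (m.+1%:Z + n)%R = (m%:Z + n + 1)%R); last lia.
  rewrite zpowS IHm mulgA -zpowS; congr (zpow _ _ * _); lia.
apply: (mulgI x); rewrite mulgA -!zpowS.
rewrite (_ : (- m.+1%:Z + n + 1)%R = (- m%:Z + n)%R); last lia.
by rewrite (_ : (- m.+1%:Z + 1)%R = (- m%:Z)%R); last lia.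
Qed.

Lemma zpow0 x : zpow x 0 = 1. Proof. exact: expg0. Qed.

Lemma zpow1 x : zpow x 1 = x. Proof. exact: expg1. Qed.

Lemma zpowN x n : zpow x (- n)%R = (zpow x n)^-1.
Proof.
apply: (mulgI (zpow x n)); rewrite mulgV -zpowD.
by rewrite (_ : (n - n)%R = 0) //; lia.
Qed.

End IntegerPowers.

Section Amalgam.
Variables (H : groupType) (z : bool -> H).
Hypothesis z_inf : forall e n, zpow (z e) n = 1 -> n = 0.
Implicit Types (e : bool) (f h s : H) (n m k d : int) (l r : seq (bool * H)).

Notation zp e n := (zpow (z e) n).

Lemma zp_inj e : injective (fun n => zp e n).
Proof.
move=> m n eq_mn; suff: (m - n)%R = 0 by lia.
by apply: (@z_inf e); rewrite zpowD zpowN eq_mn mulgV.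
Qed.

Definition in_z e f : bool := `[< exists n, f = zp e n >].

Lemma in_zP e f : reflect (exists n, f = zp e n) (in_z e f).
Proof. exact: asboolP. Qed.

Lemma in_z_zp e n : in_z e (zp e n).
Proof. by apply/in_zP; exists n. Qed.

Lemma in_z_mull e n f : in_z e (zp e n * f) = in_z e f.
Proof.
apply/in_zP/in_zP=> [[m eq_m] | [m ->]]; last by exists (n + m)%R; rewrite zpowD.
exists (- n + m)%R; rewrite zpowD -eq_m mulgA -zpowD.
by rewrite (_ : (- n + n)%R = 0) ?mul1g //; lia.
Qed.

Lemma in_z_mulr e n f : in_z e (f * zp e n) = in_z e f.
Proof.
apply/in_zP/in_zP=> [[m eq_m] | [m ->]]; last by exists (m + n)%R; rewrite zpowD.
by exists (m - n)%R; rewrite zpowD -eq_m zpowN mulgK.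
Qed.

(** The choice depends only on the coset of f by the powers of z, since [choose] depends
    only on the extension of the predicate; the trivial coset is represented by 1. *)
Definition rep e f : H :=
  if in_z e f then 1 else choose (fun h => `[< exists n, h = zp e n * f >]) f.

Definition zcoef e f : int := xget (0 : int) [set n : int | f = zp e n * rep e f].

Lemma rep_zp e n f : rep e (zp e n * f) = rep e f.
Proof.
rewrite /rep in_z_mull; case: ifP => // _.
have eq_coset : (fun h => `[< exists m, h = zp e m * (zp e n * f) >])
             =1 (fun h => `[< exists m, h = zp e m * f >]).
  move=> h; apply/asboolP/asboolP=> -[m ->].
    by exists (m + n)%R; rewrite zpowD mulgA.
  exists (m - n)%R; rewrite zpowD zpowN -!mulgA; congr (_ * _).
  by rewrite mulKg.
rewrite (eq_choose eq_coset); apply: choose_id; apply/asboolP; first by exists n.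
by exists 0; rewrite zpow0 mul1g.
Qed.

Lemma zcoefP e f : f = zp e (zcoef e f) * rep e f.
Proof.
have [n eq_n] : exists n, f = zp e n * rep e f.
  rewrite /rep; case: ifP => [/in_zP[n ->] | _]; first by exists n; rewrite mulg1.
  set P := fun h => _; have /asboolP[n ->] : P (choose P f).
    by apply: chooseP; apply/asboolP; exists 0; rewrite zpow0 mul1g.
  by exists (- n)%R; rewrite zpowN mulKg.
by have := @xgetI _ (0 : int) [set n : int | f = zp e n * rep e f] n eq_n.
Qed.

Lemma rep_in_z e f : in_z e f -> rep e f = 1.
Proof. by rewrite /rep => ->. Qed.

Lemma in_z_rep e f : in_z e (rep e f) = in_z e f.
Proof. by rewrite [in RHS](zcoefP e f) in_z_mull. Qed.

Lemma rep_rep e f : rep e (rep e f) = rep e f.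
Proof. by rewrite [in RHS](zcoefP e f) rep_zp. Qed.

Lemma zcoef_zp e n f : zcoef e (zp e n * f) = (n + zcoef e f)%R.
Proof.
apply: (@zp_inj e); apply: (mulIg (rep e f)).
by rewrite -[in LHS](rep_zp e n) -zcoefP zpowD -mulgA -zcoefP.
Qed.

Lemma zcoef_rep e s : rep e s = s -> zcoef e s = 0.
Proof.
move=> rep_s; apply: (@zp_inj e); apply: (mulIg s).
by rewrite zpow0 mul1g -{2}rep_s -zcoefP.
Qed.

Lemma zcoef_z e n : zcoef e (zp e n) = n.
Proof.
by apply: (@zp_inj e); rewrite [RHS](zcoefP e) rep_in_z ?mulg1 // in_z_zp.
Qed.

(** The permutation representation: a state (n, l) stands for the product of the
    n-th power of z with the coset representatives in l. Bringing it to the form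
    (f, l') where l' does not begin with a representative of side e identifies
    the states with the pairs (f, l'), on which H acts by multiplication. *)
Definition state := (int * seq (bool * H))%type.

Definition peel e (x : state) : H * seq (bool * H) :=
  if x.2 is (e', s) :: l' then
    if e' == e then (zp e x.1 * s, l') else (zp e x.1, x.2)
  else (zp e x.1, x.2).

Definition unpeel e (p : H * seq (bool * H)) : state :=
  (zcoef e p.1, if in_z e p.1 then p.2 else (e, rep e p.1) :: p.2).

Definition act e f (x : state) : state :=
  unpeel e (f * (peel e x).1, (peel e x).2).

Definition alternating l := sorted (fun p q => p.1 != q.1) l.
Definition starts_with e l := if l is (e', _) :: _ then e' == e else false.
Definition canonical l := all (fun p => (rep p.1 p.2 == p.2) && ~~ in_z p.1 p.2) l.

(** The normal forms. Other states need not be fixed by the action of 1. *)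
Definition valid (x : state) := alternating x.2 && canonical x.2.

Lemma peelK e x : valid x -> unpeel e (peel e x) = x.
Proof.
case: x => n [|[e' s] l] /andP[/= alt_l] /=.
  by rewrite /unpeel /= in_z_zp zcoef_z.
case/andP=> /andP[/eqP rep_s notz_s] can_l.
rewrite /unpeel /peel /=; case: eqP => [<- | _] /=; last by rewrite in_z_zp zcoef_z.
rewrite in_z_mull (negPf notz_s) rep_zp rep_s zcoef_zp zcoef_rep //.
by rewrite GRing.addr0.
Qed.

Lemma unpeelK e f l : ~~ starts_with e l -> peel e (unpeel e (f, l)) = (f, l).
Proof.
rewrite /peel /unpeel /= => start_l; have f_eq := zcoefP e f.
case: ifP => [/rep_in_z rep_f | _]; last by rewrite eqxx -f_eq.
rewrite rep_f mulg1 in f_eq; rewrite -f_eq.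
by case: l start_l => //= -[e' s] l /negPf->.
Qed.

Lemma peel_starts e x : alternating x.2 -> ~~ starts_with e (peel e x).2.
Proof.
case: x => n [|[e' s] l] //= alt_l; rewrite /peel /=.
case: eqP => [eq_e | /eqP ne_e] //=.
by case: l alt_l => //= -[e'' s'] l /= /andP[]; rewrite eq_e eq_sym.
Qed.

Lemma act_valid e f x : valid x -> valid (act e f x).
Proof.
move=> /andP[alt_x can_x]; have := peel_starts e alt_x.
have [alt_p can_p] : alternating (peel e x).2 /\ canonical (peel e x).2.
  case: x alt_x can_x => n [|[e' s] l] //= alt_l can_l; rewrite /peel /=.
  case: eqP => //= _; case/andP: can_l => _ ->; split=> //.
  exact: path_sorted alt_l.
rewrite /act /unpeel /valid /=; case: ifP => [_ _ | notz start_p].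
  by rewrite alt_p.
rewrite /canonical /= rep_rep eqxx in_z_rep notz /= -/(canonical _) can_p andbT.
by case: (peel e x).2 start_p alt_p => //= -[e' s] l; rewrite /= eq_sym => ->.
Qed.

Lemma act1 e x : valid x -> act e 1 x = x.
Proof. by move=> val_x; rewrite /act mul1g -surjective_pairing peelK. Qed.

Lemma actM e f h x : valid x -> act e (f * h) x = act e f (act e h x).
Proof.
case/andP=> alt_x _; rewrite /act unpeelK; last exact: peel_starts.
by rewrite mulgA.
Qed.

(** The powers of z act in the same way from both sides, so the actions of the two
    groups combine to an action of the amalgam. *)
Lemma act_zp e n x : valid x -> act e (zp e n) x = ((n + x.1)%R, x.2).
Proof.
move=> val_x; rewrite -[RHS](@peelK e) // /act; congr unpeel.
case: x val_x => m [|[e' s] l] _; rewrite /peel /= ?zpowD //.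
by case: eqP => // _; rewrite mulgA.
Qed.

Definition acts l (x : state) := foldr (fun p => act p.1 p.2) x l.

Definition essential l := alternating l && all (fun p => ~~ in_z p.1 p.2) l.

(** The equality of z^n l and z^m r in the amalgam, for alternating l and r: the factors
    at the same place differ by a power of z on each side, where the right one is
    compensated by the next factors. *)
Fixpoint shifted n l m r {struct l} : Prop :=
  match l, r with
  | [::], [::] => n = m
  | (e, s) :: l', (e', s') :: r' =>
      e = e' /\ exists2 d, zp e n * s = zp e m * s' * zp e d & shifted d l' 0 r'
  | _, _ => False
  end.

(** A product is evaluated from the right. Each factor takes over the power of z that the
    following factors leave, and leaves one in turn; it never becomes a power of z. *)
Lemma acts_cons e s l : essential ((e, s) :: l) -> forall k r,
  acts l (0 : int, [::]) = (k, r) -> map fst r = map fst l ->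
  acts ((e, s) :: l) (0 : int, [::])
    = (zcoef e (s * zp e k), (e, rep e (s * zp e k)) :: r).
Proof.
case/andP=> alt_l /andP[/= notz_s _] k r acts_l sides_r; rewrite acts_l.
have -> : act e s (k, r) = unpeel e (s * zp e k, r).
  rewrite /act /peel /=; case: r l alt_l sides_r {acts_l} => [|[e' s'] r] [|[e'' s''] l] //=.
  by case/andP=> ne_e _ [-> _]; rewrite eq_sym (negPf ne_e).
by rewrite /unpeel /= in_z_mulr (negPf notz_s).
Qed.

Lemma essential_behead p l : essential (p :: l) -> essential l.
Proof. by case/andP=> /= /path_sorted alt_l /andP[_ ess_l]; apply/andP. Qed.

Lemma acts_sides l : essential l -> map fst (acts l (0 : int, [::])).2 = map fst l.
Proof.
elim: l => // -[e s] l IHl ess_l; have ess_l' := essential_behead ess_l.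
case E: (acts l (0 : int, [::])) (IHl ess_l') => [k r] sides_r.
by rewrite (acts_cons ess_l E sides_r) /= -sides_r.
Qed.

(** The normal form theorem: the representatives can be read off from the action
    on the trivial state. *)
Lemma shifted_of_acts l r n m : essential l -> essential r ->
    (n + (acts l (0 : int, [::])).1 = m + (acts r (0 : int, [::])).1)%R ->
    (acts l (0 : int, [::])).2 = (acts r (0 : int, [::])).2 ->
  shifted n l m r.
Proof.
elim: l r n m => [|[e s] l IHl] [|[e' s'] r] n m ess_l ess_r.
- by rewrite /=; lia.
- by move=> _ /(congr1 (map fst)); rewrite (acts_sides ess_r).
- by move=> _ /(congr1 (map fst)); rewrite (acts_sides ess_l).
have ess_l' := essential_behead ess_l; have ess_r' := essential_behead ess_r.
case El: (acts l (0 : int, [::])) (acts_sides ess_l') => [k t] sides_t.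
case Er: (acts r (0 : int, [::])) (acts_sides ess_r') => [k' t'] sides_t'.
rewrite (acts_cons ess_l El sides_t) (acts_cons ess_r Er sides_t') /=.
move=> coef_eq [eq_e rep_eq eq_t]; rewrite -eq_e in rep_eq coef_eq ess_r *.
split=> //; exists (k' - k)%R; last first.
  by apply: IHl => //; rewrite El Er //=; lia.
apply: (mulIg (zp e k)); rewrite -!mulgA -zpowD (_ : (k' - k + k)%R = k'); last lia.
rewrite [s * _](zcoefP e) [s' * _](zcoefP e) -rep_eq !mulgA -!zpowD.
by rewrite coef_eq.
Qed.

End Amalgam.

(** * Syllables *)

Section Products.
Variables (B : choiceType) (Q : seq (word B)).
Implicit Types (f h : free_group B).

Lemma product_of1 : product_of Q 1.
Proof. by exists [::]. Qed.

Lemma product_ofM f h : product_of Q f -> product_of Q h -> product_of Q (f * h).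
Proof.
move=> [ws Qws ->] [ws' Qws' ->]; exists (ws ++ ws').
  by move=> q; rewrite mem_cat => /orP[/Qws | /Qws'].
by rewrite flatten_cat free_of_cat.
Qed.

Lemma product_of_mem q : q \in Q -> product_of Q (free_of q).
Proof. by exists [:: q] => [p|]; rewrite ?mem_seq1 /= ?cats0 // => /eqP->. Qed.

Lemma product_of_ind (P : free_group B -> Prop) :
    P 1 -> (forall q f, q \in Q -> product_of Q f -> P f -> P (free_of q * f)) ->
  forall f, product_of Q f -> P f.
Proof.
move=> P1 PM f [ws Qws ->]; elim: ws Qws => //= q ws IHws Qws.
have Qws' : {subset ws <= Q} by move=> p p_in; apply: Qws; rewrite in_cons p_in orbT.
by rewrite free_of_cat; apply: PM; [apply: Qws; apply: mem_head | exists ws | apply: IHws].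
Qed.

Lemma product_of_sub (Q' : seq (word B)) f :
  (forall q, q \in Q -> product_of Q' (free_of q)) -> product_of Q f -> product_of Q' f.
Proof.
move=> sub_Q; elim/product_of_ind; first by exists [::].
move=> q {}f Qq _ Q'f; have [ws Qws q_eq] := sub_Q q Qq; have [ws' Qws' ->] := Q'f.
exists (ws ++ ws'); last by rewrite flatten_cat free_of_cat q_eq.
by move=> p; rewrite mem_cat => /orP[/Qws | /Qws'].
Qed.

End Products.

Section Syllables.
Variables (B : choiceType) (Q : seq (word B)).
Hypothesis Q_powers : forall q, q \in Q -> exists k x, q = nseq k x.
Implicit Types (x y : B * bool) (s t u v w : word B) (f h : free_group B).

Definition apart x y := x.1 != y.1.

Inductive syllabic : word B -> Prop :=
| syllabic_nil : syllabic [::]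
| syllabic_cons k x w : product_of Q (free_of (nseq k.+1 x)) -> syllabic w ->
    (if w is y :: _ then apart x y else true) -> syllabic (nseq k.+1 x ++ w).

Lemma apart_reduced w : sorted apart w -> reduced w.
Proof.
apply: sub_sorted => x y; apply: contraNneq => ->.
by [].
Qed.

Lemma reduced_nseq_cat k x w : reduced w ->
  (if w is y :: _ then apart x y else true) -> reduced (nseq k x ++ w).
Proof.
move=> red_w apart_w; elim: k => //= k IHk.
case: k IHk => [_ | k] /=; last by rewrite eq_sym letter_inv_neq.
case: w red_w apart_w => //= y w -> apart_xy; rewrite andbT.
by apply: contraNneq apart_xy => ->; rewrite /apart /= eqxx.
Qed.

Lemma syllabic_reduced w : syllabic w -> reduced w.
Proof. by elim=> // k x {}w _ _ red_w /reduced_nseq_cat; apply. Qed.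

Lemma syllabic_nseq k x w : product_of Q (free_of (nseq k x)) -> syllabic w ->
  (if w is y :: _ then apart x y else true) -> syllabic (nseq k x ++ w).
Proof. by case: k => // k; apply: syllabic_cons. Qed.

Lemma word_inv_nseq k x : word_inv (nseq k x) = nseq k (letter_inv x).
Proof.
elim: k => //= k IHk; rewrite word_inv_cons IHk.
by elim: k {IHk} => //= k ->.
Qed.

Lemma free_of_nseqD j k x : free_of (nseq (j + k) x) = free_of (nseq j x) * free_of (nseq k x).
Proof. by rewrite nseqD free_of_cat. Qed.

Lemma free_of_nseqB j k x : j <= k ->
  free_of (nseq j (letter_inv x)) * free_of (nseq k x) = free_of (nseq (k - j) x).
Proof.
by move=> le_jk; rewrite -(subnKC le_jk) free_of_nseqD addKn -word_inv_nseq free_of_inv mulKg.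
Qed.

Lemma free_of_nseqB' j k x : j <= k ->
  free_of (nseq k x) * free_of (nseq j (letter_inv x)) = free_of (nseq (k - j) x).
Proof.
move=> le_jk; rewrite -{1}(subnK le_jk) free_of_nseqD -word_inv_nseq free_of_inv.
by rewrite mulgK.
Qed.

(** A power of a letter either becomes a new first syllable or is merged with the first
    syllable. In the second case the new exponent is still admissible, because the
    submonoid is closed under products. *)
Lemma syllabic_mul j y f : product_of Q (free_of (nseq j y)) ->
  syllabic (free_val f) -> syllabic (free_val (free_of (nseq j y) * f)).
Proof.
move=> Qy syl_f; rewrite -[f]free_of_val -free_of_cat.
have done w : syllabic w -> syllabic (free_val (free_of w)).
  by move=> syl_w; rewrite /= reduce_id // syllabic_reduced.
move: syl_f; case=> [|k x w Qx syl_w apart_w].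
  by rewrite cats0; apply: done; rewrite -[nseq j y]cats0; apply: syllabic_nseq => //; left.
have [eq_yx | apart_yx] := eqVneq y.1 x.1; last first.
  by apply: done; apply: (syllabic_nseq Qy) => //; apply: syllabic_cons.
have [i [x' [eq_x mulE]]] : exists i x', x'.1 = x.1 /\
    free_of (nseq j y) * free_of (nseq k.+1 x) = free_of (nseq i x').
  have [-> | ne_yx] := eqVneq y x; first by exists (j + k.+1), x; rewrite -free_of_nseqD.
  have -> : y = letter_inv x.
    case: x y eq_yx ne_yx {Qx Qy apart_w} => b e [b' e'] /= ->.
    by rewrite xpair_eqE eqxx /letter_inv /=; case: e e' => -[].
  have [le_jk | /ltnW le_kj] := leqP j k.+1.
    by exists (k.+1 - j), x; rewrite free_of_nseqB.
  exists (j - k.+1), (letter_inv x); split=> //.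
  by rewrite -[X in nseq k.+1 X]letter_invK free_of_nseqB'.
have Qx' := product_ofM Qy Qx; rewrite mulE in Qx'.
rewrite catA free_of_cat [free_of (_ ++ _)]free_of_cat mulE -free_of_cat.
apply: done; apply: (syllabic_nseq Qx' syl_w).
by rewrite /apart eq_x.
Qed.

Lemma syllabic_product f : product_of Q f -> syllabic (free_val f).
Proof.
elim/product_of_ind => [|q {}f Qq Qf syl_f]; first exact: syllabic_nil.
have [k [x q_eq]] := Q_powers Qq; rewrite q_eq; apply: syllabic_mul => //.
by rewrite -q_eq; apply: product_of_mem.
Qed.

(** A letter whose neighbours are powers of other generators is a whole syllable. *)
Lemma syllabic_isolated s y t : syllabic (s ++ y :: t) -> sorted apart (rcons s y) ->
  forall x, x \in s -> product_of Q (free_of [:: x]).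
Proof.
elim: s => //= x s IHs.
move w_eq: (x :: s ++ y :: t) => w syl_w; case: syl_w w_eq => //= k x' v Qx' syl_v _.
case=> eq_x; rewrite -{}eq_x in Qx' * => v_eq path_s.
have k0 : k = 0.
  case: k v_eq {Qx'} => //= k; case: s path_s {IHs} => [|x1 s] /=.
    by case/andP=> + _ [eq_y _]; rewrite /apart eq_y eqxx.
  by case/andP=> + _ [eq_x1 _]; rewrite /apart eq_x1 eqxx.
rewrite k0 /= in v_eq Qx' => x1; rewrite in_cons => /predU1P[-> // | s_x1].
apply: IHs s_x1; first by rewrite v_eq.
exact: path_sorted path_s.
Qed.

End Syllables.

Section Powers.
Variable B : choiceType.
Implicit Types (u v w p : word B) (x y : B * bool).

(** Each letter of v cancels at most one letter of u. *)
Lemma reduce_cat_take u v : reduced u ->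
  exists t, reduce (u ++ v) = take (size u - size v) u ++ t.
Proof.
elim: v u => [|x v IHv] u red_u.
  by exists [::]; rewrite !cats0 subn0 take_size reduce_id.
case: (lastP u) red_u => [|u' y] red_u; first by exists (reduce (x :: v)).
have red_u' : reduced u'.
  by move: red_u; rewrite /reduced -cats1 => /cat_sorted2[].
have [eq_x | ne_x] := eqVneq x (letter_inv y).
  have [t t_eq] := IHv u' red_u'; exists t.
  rewrite eq_x cat_rcons -reduce_catr /= reduce_consK ?reduce_reduced //.
  rewrite reduce_catr t_eq size_rcons subSS -cats1 takel_cat //.
  exact: leq_subr.
have red_ux : reduced (rcons (rcons u' y) x).
  move: red_u; rewrite /reduced; case: (u') => [|a u1] /=; first by rewrite ne_x.
  by rewrite !rcons_path => ->; rewrite last_rcons.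
have [t t_eq] := IHv _ red_ux; rewrite -cat_rcons {}t_eq.
move: (rcons u' y) => u1; rewrite size_rcons /= -cats1.
have [le_v | lt_v] := leqP (size v) (size u1); last first.
  exists ((take ((size u1).+1 - size v) (u1 ++ [:: x])) ++ t).
  by rewrite (_ : size u1 - _ = 0) ?take0 //; lia.
have -> : (size u1).+1 - size v = (size u1 - (size v).+1)
    + ((size u1).+1 - size v - (size u1 - (size v).+1)).
  by lia.
move: (_ - (_ - _)) => c; rewrite takeD -catA takel_cat; last by lia.
by eexists.
Qed.

Lemma cycle_apart_pow w k : cycle (@apart B) w -> sorted (@apart B) (flatten (nseq k w)).
Proof.
case: w => [|x p]; first by elim: k.
rewrite /= rcons_path => /andP[path_p apart_x].
suff path_k y : apart y x -> path (@apart B) y (flatten (nseq k (x :: p))).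
  exact: path_sorted (path_k _ apart_x).
elim: k y => //= k IHk y apart_yx.
by rewrite apart_yx cat_path path_p IHk.
Qed.

Lemma cycle_apart_inv w : cycle (@apart B) w -> cycle (@apart B) (word_inv w).
Proof.
rewrite /word_inv rev_cycle cycle_map => cyc_w.
by rewrite -(eq_cycle (e := @apart B)) // => x y; rewrite /apart /= eq_sym.
Qed.

Lemma size_word_inv w : size (word_inv w) = size w.
Proof. by rewrite size_rev size_map. Qed.

Lemma mem_word_inv w x : (x \in word_inv w) = (letter_inv x \in w).
Proof.
rewrite mem_rev -[x in LHS]letter_invK.
by rewrite (mem_map (inv_inj (@letter_invK B))).
Qed.

Definition zword w (n : int) : word B :=
  match n with
  | Posz k => flatten (nseq k w)
  | Negz k => flatten (nseq k.+1 (word_inv w))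
  end.

Lemma free_of_flatten_nseq k w : free_of (flatten (nseq k w)) = free_of w ^+ k.
Proof. by elim: k => //= k IHk; rewrite free_of_cat IHk expgS. Qed.

Lemma free_of_zword w n : free_of (zword w n) = zpow (free_of w) n.
Proof. by case: n => k; rewrite /zword free_of_flatten_nseq // free_of_inv expVgn. Qed.

Lemma zword_reduced w n : cycle (@apart B) w -> reduced (zword w n).
Proof.
move=> cyc_w; apply: apart_reduced; case: n => k; apply: cycle_apart_pow => //.
exact: cycle_apart_inv.
Qed.

Lemma size_zword w n : size (zword w n) = (`|n| * size w)%N.
Proof.
have size_pow k v : size (flatten (nseq k v)) = (k * size v)%N.
  by elim: k => //= k IHk; rewrite size_cat IHk mulSn.
by case: n => k; rewrite /zword size_pow ?size_word_inv.
Qed.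

(** The reduced form of w^k v begins with the period w and one more letter, so that
    every letter of this period is isolated. *)
Lemma product_of_letters (Q : seq (word B)) w k v :
    (forall q, q \in Q -> exists j x, q = nseq j x) ->
    cycle (@apart B) w -> size v + 2 <= k ->
    product_of Q (free_of (flatten (nseq k w) ++ v)) ->
  forall x, x \in w -> product_of Q (free_of [:: x]).
Proof.
move=> Q_powers cyc_w le_vk /(syllabic_product Q_powers) /=.
have sorted_pow j := cycle_apart_pow j cyc_w.
have [t ->] := reduce_cat_take v (apart_reduced (sorted_pow k)).
case: k le_vk => [|[|k]] //; first by lia.
  by rewrite addn2.
case: w cyc_w sorted_pow => // y w cyc_w sorted_pow le_vk.
set u := flatten _; have size_u : size u = (k.+2 * (size w).+1)%N.
  by rewrite -(size_zword (y :: w) k.+2).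
have u_eq : u = (y :: w) ++ y :: (w ++ flatten (nseq k (y :: w))) by [].
have -> : size u - size v = size (y :: w) + (size u - size v - (size w).+2).+1.
  by rewrite size_u /=; nia.
move: (size u - _ - _) => c; rewrite takeD u_eq take_size_cat // drop_size_cat // [take _.+1 _]/=.
rewrite -catA => syl; apply: (syllabic_isolated syl).
have := sorted_pow 2; rewrite /= cats0 -cat_rcons cat_path => /andP[].
by [].
Qed.

End Powers.

(** * Two free groups amalgamated along a word *)

Lemma word_class_cat (B : choiceType) (R : set (word B)) (u v : word B) :
  word_class R u * word_class R v = word_class R (u ++ v).
Proof. exact: presented_mulE. Qed.

(** The letters are divided into two sides, and zeta e is a cyclically reduced word in
    which every letter of side e occurs and no two neighbours are powers of the same
    generator. The commutator [a_1, b_1] and the inverse of [a_2, b_2] ... [a_g, b_g] are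
    of this kind. The relator identifies zeta true with zeta false. *)
Section SurfaceAmalgam.
Variables (B : choiceType) (side : B -> bool) (zeta : bool -> word B).
Hypothesis zeta_cycle : forall e, cycle (@apart B) (zeta e).
Hypothesis zeta_neq0 : forall e, zeta e != [::].
Hypothesis mem_zeta : forall e x, (x \in zeta e) = (side x.1 == e).

Let R : set (word B) := [set zeta true ++ word_inv (zeta false)]%classic.
Notation "u ~ v" := (word_equiv R u v) (at level 70).

Implicit Types (e : bool) (f h s : free_group B) (n m d : int).
Implicit Types (u v w : word B) (l r : seq (bool * free_group B)).

Definition edge e := free_of (zeta e).

Lemma zpow_edge e n : zpow (edge e) n = free_of (zword (zeta e) n).
Proof. by rewrite free_of_zword. Qed.

Lemma val_zpow e n : free_val (zpow (edge e) n) = zword (zeta e) n.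
Proof. by rewrite zpow_edge /= reduce_id // zword_reduced. Qed.

Lemma edge_inf e n : zpow (edge e) n = 1 -> n = 0.
Proof.
move=> /(congr1 (size \o @free_val B)) /=; rewrite val_zpow size_zword.
by have := zeta_neq0 e; rewrite -size_eq0 /=; nia.
Qed.

Definition on_side e w := all (fun x => side x.1 == e) w.

Lemma on_side_cat e u v : on_side e (u ++ v) = on_side e u && on_side e v.
Proof. exact: all_cat. Qed.

Lemma on_side_reduce e w : on_side e w -> on_side e (reduce w).
Proof. by move=> /allP on_w; apply/allP=> x /reduce_sub/on_w. Qed.

Lemma on_side_inv e w : on_side e w -> on_side e (word_inv w).
Proof. by rewrite /on_side all_rev all_map. Qed.

Lemma on_side_zeta e : on_side e (zeta e).
Proof. by apply/allP=> x; rewrite mem_zeta. Qed.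

Lemma on_side_zword e n : on_side e (zword (zeta e) n).
Proof.
have on_pow w k : on_side e w -> on_side e (flatten (nseq k w)).
  by move=> on_w; elim: k => //= k IHk; rewrite on_side_cat on_w.
by case: n => k; apply: on_pow; rewrite ?on_side_inv ?on_side_zeta.
Qed.

Lemma on_side_zpow e n : on_side e (free_val (zpow (edge e) n)).
Proof. by rewrite val_zpow on_side_zword. Qed.

Lemma on_side_mul e f h : on_side e (free_val f) -> on_side e (free_val h) ->
  on_side e (free_val (f * h)).
Proof. by move=> on_f on_h; apply: on_side_reduce; rewrite on_side_cat on_f. Qed.

Notation state := (state (free_group B)).
Notation valid := (@valid (free_group B) edge).
Notation act := (@act (free_group B) edge).
Notation acts := (@acts (free_group B) edge).
Notation shifted := (@shifted (free_group B) edge).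

Definition word_act w (x : state) : state :=
  foldr (fun y => act (side y.1) (free_of [:: y])) x w.

Lemma word_act_valid w x : valid x -> valid (word_act w x).
Proof. by move=> val_x; elim: w => //= y w; apply: act_valid. Qed.

Lemma word_act_side e w x : on_side e w -> valid x -> word_act w x = act e (free_of w) x.
Proof.
move=> + val_x; elim: w => [|y w IHw] /=.
  by rewrite [free_of _]free_of_nil act1 //; apply: edge_inf.
case/andP=> /eqP-> /IHw->; rewrite -(cat1s y w) free_of_cat actM //.
Qed.

(** The relator acts trivially, because zeta true and zeta false both act by raising the
    exponent of the state by one. *)
Lemma word_act_equiv u v x : u ~ v -> valid x -> word_act u x = word_act v x.
Proof.
move=> uv; elim: uv x => {u v} [u | u v _ IH | v u w _ IH1 _ IH2
    | u u' v v' _ IHu _ IHv | b e | r ->] x val_x //.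
- by rewrite IH.
- by rewrite IH1 ?IH2.
- rewrite /word_act !foldr_cat -!/(word_act _ _) IHv // IHu //.
  exact: word_act_valid.
- rewrite (@word_act_side (side b)) //; last by rewrite /on_side /= !eqxx.
  rewrite (_ : free_of _ = 1) ?act1 //; first exact: edge_inf.
  by apply: val_inj; rewrite /= eqxx.
rewrite /word_act foldr_cat -!/(word_act _ _).
rewrite (word_act_side (on_side_inv (on_side_zeta false))) //.
rewrite free_of_inv -[free_of _]zpow1 -zpowN act_zp //; last exact: edge_inf.
rewrite (word_act_side (on_side_zeta true)) //.
rewrite -[free_of _]zpow1 act_zp //; first by case: x {val_x} => k l /=; congr (_, _); lia.
exact: edge_inf.
Qed.

Definition state_word (x : state) : word B :=
  zword (zeta true) x.1 ++ flatten [seq free_val p.2 | p <- x.2].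

Definition proper l := essential edge l && all (fun p => on_side p.1 (free_val p.2)) l.

Lemma word_act_state x : proper x.2 ->
  word_act (state_word x) (0 : int, [::])
    = ((x.1 + (acts x.2 (0 : int, [::])).1)%R, (acts x.2 (0 : int, [::])).2).
Proof.
case: x => n l /andP[_ /= on_l]; rewrite /state_word /word_act foldr_cat -!/(word_act _ _) /=.
have [-> val_l] : word_act (flatten [seq free_val p.2 | p <- l]) (0 : int, [::])
    = acts l (0 : int, [::]) /\ valid (acts l (0 : int, [::])).
  elim: l on_l => //= -[e f] l IHl /andP[/= on_f /IHl[IH val_l]].
  split; last exact: act_valid.
  by rewrite /word_act foldr_cat -!/(word_act _ _) IH (word_act_side on_f) // free_of_val.
rewrite (word_act_side (on_side_zword true n)) // -zpow_edge act_zp //; exact: edge_inf.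
Qed.

Lemma shifted_of_equiv n l m r : proper l -> proper r ->
  state_word (n, l) ~ state_word (m, r) -> shifted n l m r.
Proof.
move=> prop_l prop_r eq_lr.
have val0 : valid (0 : int, [::]) by [].
have := word_act_equiv eq_lr val0; rewrite !word_act_state //= => -[eq_n eq_acts].
case/andP: prop_l prop_r => ess_l _ /andP[ess_r _].
by apply: shifted_of_acts => //; apply: edge_inf.
Qed.

(** The exponents of f as a power of zeta e. The search may stop at the length of f,
    which is at least the absolute value of the exponent. *)
Definition zlogs e f : seq int :=
  let ks := iota 0 (size (free_val f)).+1 in
  [seq n <- [seq Posz k | k <- ks] ++ [seq Negz k | k <- ks] | zword (zeta e) n == free_val f].

Lemma zlogsP e f :
  if zlogs e f is n :: _ then f = zpow (edge e) n else is_true (~~ in_z edge e f).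
Proof.
have memP n : n \in zlogs e f -> f = zpow (edge e) n.
  by rewrite mem_filter => /andP[/eqP eq_n _]; apply: val_inj; rewrite /= val_zpow.
case E: (zlogs e f) memP => [|n l] memP; last by apply: memP; apply: mem_head.
apply/in_zP=> -[n f_eq]; suff: n \in zlogs e f by rewrite E.
rewrite mem_filter f_eq val_zpow eqxx mem_cat size_zword.
have := zeta_neq0 e; rewrite -size_eq0 -lt0n => nz_z.
case: n {f_eq} => k; apply/orP; [left | right]; apply/mapP; exists k => //;
  rewrite mem_iota /= add0n ltnS ?leq_pmulr //.
exact: leq_trans (leqnSn k) (leq_pmulr _ nz_z).
Qed.

(** This is [act] without the coset representatives, whose choice is not effective: a
    factor is kept as it is, unless it is a power of zeta. The result is an alternating
    product, which is no longer unique. *)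
Definition state_mul e f (x : state) : state :=
  let p := peel edge e x in let h := f * p.1 in
  if zlogs e h is n :: _ then (n, p.2) else (0 : int, (e, h) :: p.2).

Notation elt f := (word_class R (free_val f)).

Lemma eltM f h : elt (f * h) = elt f * elt h.
Proof.
rewrite word_class_cat; apply/word_classP.
exact: word_equiv_reduce.
Qed.

Lemma elt_of w : elt (free_of w) = word_class R w.
Proof. by apply/word_classP/word_equiv_reduce. Qed.

Lemma elt_zpow e n : elt (zpow (edge e) n) = word_class R (zword (zeta true) n).
Proof.
rewrite zpow_edge elt_of; case: e => //; apply/word_classP/we_sym.
have eq_z : zeta true ~ zeta false.
  apply: (@we_trans _ _ (zeta true ++ (word_inv (zeta false) ++ zeta false))).
    rewrite -[X in X ~ _]cats0; apply: we_cat; first exact: we_refl.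
    by apply: word_equiv_of_reduce; rewrite reduce_mulVl.
  rewrite catA -[X in _ ~ X]cat0s; apply: we_cat; last exact: we_refl.
  exact: we_relator.
have eq_pow u v k : u ~ v -> flatten (nseq k u) ~ flatten (nseq k v).
  by move=> eq_uv; elim: k => [|k IHk]; [apply: we_refl | apply: we_cat].
by case: n => k; apply: eq_pow => //; apply: word_equiv_inv.
Qed.

Lemma zword_class e n : word_class R (zword (zeta e) n) = word_class R (zword (zeta true) n).
Proof. by rewrite -(elt_zpow e) zpow_edge elt_of. Qed.

Definition state_elt (x : state) := word_class R (state_word x).

Lemma state_elt_cons e s l n :
  state_elt (n, (e, s) :: l) = word_class R (zword (zeta true) n) * elt s * state_elt (0 : int, l).
Proof.
by rewrite !word_class_cat /state_elt /state_word /= -!catA.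
Qed.

Lemma state_elt_split n l :
  state_elt (n, l) = word_class R (zword (zeta true) n) * state_elt (0 : int, l).
Proof. by rewrite word_class_cat. Qed.

Lemma state_elt_peel e x :
  state_elt x = elt (peel edge e x).1 * state_elt (0 : int, (peel edge e x).2).
Proof.
have gsE n l : state_elt (n, l) = elt (zpow (edge e) n) * state_elt (0 : int, l).
  by rewrite elt_zpow -state_elt_split.
case: x => n [|[e' s] l]; first exact: gsE.
rewrite /peel; cbn [fst snd]; case: eqP => [eq_e | _]; last exact: gsE.
by rewrite eq_e state_elt_cons eltM elt_zpow.
Qed.

Lemma state_elt_step e f x : state_elt (state_mul e f x) = elt f * state_elt x.
Proof.
rewrite /state_mul; have := zlogsP e (f * (peel edge e x).1).
rewrite [in RHS](state_elt_peel e) mulgA -eltM.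
case: zlogs => [_ | n _ ->]; last by rewrite state_elt_split elt_zpow.
by rewrite state_elt_cons /= mul1g.
Qed.

Lemma state_mul_proper e f x : on_side e (free_val f) -> proper x.2 -> proper (state_mul e f x).2.
Proof.
move=> on_f /andP[/andP[alt_x ess_x] on_x]; have := peel_starts edge e alt_x.
have [alt_p ess_p on_p on_h] : [/\ alternating (peel edge e x).2,
    all (fun p => ~~ in_z edge p.1 p.2) (peel edge e x).2,
    all (fun p => on_side p.1 (free_val p.2)) (peel edge e x).2
    & on_side e (free_val (peel edge e x).1)].
  case: x alt_x ess_x on_x => n [|[e' s] l] //= alt_x ess_x on_x.
    by split=> //; apply: on_side_zpow.
  rewrite /peel /=; case: eqP => [eq_e | _] /=; last by split=> //; apply: on_side_zpow.
  case/andP: ess_x on_x => _ ess_x /andP[/= on_s on_x]; split=> //.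
    exact: path_sorted alt_x.
  by rewrite on_side_mul ?on_side_zpow // -eq_e.
rewrite /state_mul; have := zlogsP e (f * (peel edge e x).1).
case: zlogs => [notz start_p | n _ _]; rewrite /proper /essential /=; last by rewrite alt_p ess_p.
rewrite notz ess_p on_side_mul // on_p !andbT.
by case: (peel edge e x).2 start_p alt_p => //= -[e' s] l; rewrite /= eq_sym => ->.
Qed.

Definition reduced_form w : state :=
  foldr (fun y => state_mul (side y.1) (free_of [:: y])) (0 : int, [::]) w.

Lemma reduced_form_proper w : proper (reduced_form w).2.
Proof. by elim: w => //= y w; apply: state_mul_proper; rewrite /on_side /= eqxx. Qed.

Lemma state_elt_normal w : state_elt (reduced_form w) = word_class R w.
Proof.
elim: w => [|y w IHw]; first by rewrite /state_elt /state_word /=.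
by rewrite [reduced_form _]/= state_elt_step IHw elt_of word_class_cat.
Qed.

Lemma reduced_form_equiv w : state_word (reduced_form w) ~ w.
Proof. exact/word_classP/state_elt_normal. Qed.

(** The empty product is only related to itself. *)
Lemma reduced_form_trivial w : w ~ [::] <-> reduced_form w = (0 : int, [::]).
Proof.
split=> [w1 | w_eq]; last first.
  by apply: we_trans (we_sym (reduced_form_equiv w)) _; rewrite w_eq; apply: we_refl.
have := @shifted_of_equiv (reduced_form w).1 (reduced_form w).2 0 [::] (reduced_form_proper w) isT.
rewrite -surjective_pairing => /(_ (we_trans (reduced_form_equiv w) w1)).
by case: (reduced_form w) => n [|[e s] l] //= ->.
Qed.

Variable Q : seq (word B).
Hypothesis Q_powers : forall q, q \in Q -> exists k x, q = nseq k x.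

Definition side_gens e := [seq q <- Q | on_side e q].

(** The submonoid contains the free group on side e. *)
Definition covers e := forall x, side x.1 = e -> product_of (side_gens e) (free_of [:: x]).

(** These generate the intersection of the submonoid with the free group on side e: if
    the other side is contained in the submonoid, then the powers of zeta are, too. *)
Definition local_gens e :=
  side_gens e ++ (if `[< covers (~~ e) >] then [:: zeta e; word_inv (zeta e)] else [::]).

Definition z_inside := covers true \/ covers false.

Lemma covers_product e w : covers e -> on_side e w -> product_of (side_gens e) (free_of w).
Proof.
move=> covers_e; elim: w => [_|x w IHw /andP[/eqP side_x /IHw Qw]]; first exact: product_of1.
by rewrite -cat1s free_of_cat; apply: product_ofM Qw; apply: covers_e.
Qed.

Lemma side_gens_local e q : q \in side_gens e -> q \in local_gens e.
Proof. by rewrite mem_cat => ->. Qed.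

Lemma local_gens_outside e : ~ z_inside -> local_gens e = side_gens e.
Proof.
move=> notz; rewrite /local_gens; case: asboolP; last by rewrite cats0.
by move=> covers_e; case: notz; case: e covers_e; [right | left].
Qed.

Lemma product_of_side_gens e f : product_of (side_gens e) f -> product_of (local_gens e) f.
Proof. by apply: product_of_sub => q /side_gens_local; apply: product_of_mem. Qed.

Lemma product_of_zpow e n : z_inside -> product_of (local_gens e) (zpow (edge e) n).
Proof.
move=> z_in; have [covers_e | not_covers] := pselect (covers e).
  apply: product_of_side_gens; rewrite zpow_edge; apply: covers_product => //.
  exact: on_side_zword.
have covers_e' : covers (~~ e) by case: z_in not_covers; case: e.
have local_gens_z : {subset [:: zeta e; word_inv (zeta e)] <= local_gens e}.
  by move=> q q_in; rewrite mem_cat (asboolT covers_e') q_in orbT.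
rewrite zpow_edge.
case: n => k; [exists (nseq k (zeta e)) | exists (nseq k.+1 (word_inv (zeta e)))] => // q.
  by case/nseqP=> -> _; apply: local_gens_z; rewrite !inE eqxx.
by case/nseqP=> -> _; apply: local_gens_z; rewrite !inE eqxx orbT.
Qed.

Lemma side_gens_powers e q : q \in side_gens e -> exists k x, q = nseq k x.
Proof. by rewrite mem_filter => /andP[_ /Q_powers]. Qed.

(** Otherwise a period of zeta and one more letter would survive in the reduced word, so
    that every letter of side e would be in the submonoid. *)
Lemma zpow_bound e n f : ~ covers e -> product_of (side_gens e) (zpow (edge e) n * f) ->
  (`|n| < size (free_val f) + 2)%N.
Proof.
move=> not_covers; rewrite zpow_edge -[f]free_of_val -free_of_cat free_of_val => Qnf.
rewrite ltnNge; apply: contra_notN not_covers => le_n x side_x.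
have [w [k [cyc_w le_k wE xw]]] : exists w k, [/\ cycle (@apart B) w,
    size (free_val f) + 2 <= k, zword (zeta e) n = flatten (nseq k w) & x \in w].
  case: n le_n {Qnf} => k le_n; first by exists (zeta e), k; rewrite mem_zeta side_x.
  exists (word_inv (zeta e)), k.+1; rewrite mem_word_inv mem_zeta side_x eqxx.
  by split=> //; apply: cycle_apart_inv.
rewrite wE in Qnf.
exact: product_of_letters (@side_gens_powers e) cyc_w le_k Qnf _ xw.
Qed.

(** The exponent of the square is at most 1 by [zpow_bound]. *)
Lemma zpow_outside e n : ~ covers e -> product_of (side_gens e) (zpow (edge e) n) -> n = 0.
Proof.
move=> not_covers Qn.
suff: (`|(n + n)%R| < 2)%N by lia.
rewrite -[2]add0n; apply: (@zpow_bound e _ 1) => //.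
by rewrite mulg1 zpowD; apply: product_ofM.
Qed.

Definition inside (x : state) :=
  (forall p, p \in x.2 -> product_of (local_gens p.1) p.2) /\ (x.1 = 0 \/ z_inside).

(** If a nontrivial power of zeta appears as a factor, then one of the sides is covered
    by [zpow_outside], so that this power may be moved to the front. *)
Lemma state_mul_inside e f x : product_of (local_gens e) f -> inside x -> inside (state_mul e f x).
Proof.
move=> Qf [Qx zx].
have [Qp1 Qp2] : product_of (local_gens e) (peel edge e x).1 /\
    forall p, p \in (peel edge e x).2 -> product_of (local_gens p.1) p.2.
  have Qz : product_of (local_gens e) (zpow (edge e) x.1).
    by case: zx => [-> | zx]; [apply: product_of1 | apply: product_of_zpow].
  case: x Qx zx Qz => n [|[e' s] l] //= Qx zx Qz; rewrite /peel /=.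
  case: eqP => [eq_e | _] //=; split; last first.
    by move=> p p_in; apply: Qx; rewrite in_cons p_in orbT.
  by apply: product_ofM Qz _; rewrite -eq_e; apply: (Qx (e', s)); apply: mem_head.
have Qfp := product_ofM Qf Qp1.
rewrite /state_mul; have := zlogsP e (f * (peel edge e x).1).
case: zlogs => [_ | n _ fp_eq]; split=> //=; last first.
- have [z_in | z_out] := pselect z_inside; [by right | left].
  rewrite fp_eq local_gens_outside // in Qfp; apply: zpow_outside Qfp.
  by move=> covers_e; apply: z_out; case: (e) covers_e; [left | right].
- by left.
by move=> p; rewrite in_cons => /predU1P[-> | /Qp2].
Qed.

Lemma product_inside ws : {subset ws <= Q} ->
  exists x, [/\ proper x.2, inside x & state_elt x = word_class R (flatten ws)].
Proof.
elim: ws => [|q ws IHws] Qws; first by exists (0 : int, [::]); split=> //; split=> //; left.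
have [p p_in | x [prop_x in_x x_eq]] := IHws; first by apply: Qws; rewrite in_cons p_in orbT.
have Qq : q \in Q by apply: Qws; apply: mem_head.
have [e on_q] : exists e, on_side e q.
  have [k [y ->]] := Q_powers Qq; exists (side y.1).
  by rewrite /on_side all_nseq eqxx orbT.
exists (state_mul e (free_of q) x); split.
- by apply: state_mul_proper => //; apply: on_side_reduce.
- apply: state_mul_inside in_x; apply: product_of_side_gens; apply: product_of_mem.
  by rewrite mem_filter on_q.
by rewrite state_elt_step elt_of x_eq word_class_cat.
Qed.

(** If the word is a power of zeta e, then it is equal to a power of the other zeta, and
    the other side is covered. *)
Lemma local_gens_word e q : q \in local_gens e ->
  exists2 ws, {subset ws <= Q} & q ~ flatten ws.
Proof.
rewrite mem_cat => /orP[|].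
  rewrite mem_filter => /andP[_ Qq]; exists [:: q]; last by rewrite /= cats0; apply: we_refl.
  by move=> p; rewrite inE => /eqP->.
case: asboolP => // covers_e q_in.
have [n q_eq] : exists n, q = zword (zeta e) n.
  move: q_in; rewrite !inE => /orP[] /eqP->; first by exists (Posz 1); rewrite /= cats0.
  by exists (Negz 0); rewrite /= cats0.
have [ws Qws ws_eq] := covers_product covers_e (on_side_zword (~~ e) n).
exists ws; first by move=> p /Qws; rewrite mem_filter => /andP[].
apply: (@we_trans _ _ (zword (zeta (~~ e)) n)).
  by apply/word_classP; rewrite q_eq (zword_class e) (zword_class (~~ e)).
by apply: word_equiv_of_reduce; case: ws_eq.
Qed.

(** The bound of [bounded_product] on each side, with the generators rewritten in Q. *)
Lemma product_word : exists C, forall e f, product_of (local_gens e) f ->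
  exists ws, [/\ {subset ws <= Q}, free_val f ~ flatten ws
               & (size ws <= C * (size (free_val f)).+1)%N].
Proof.
suff bound e : exists C, forall f, product_of (local_gens e) f ->
    exists ws, [/\ {subset ws <= Q}, free_val f ~ flatten ws
                 & (size ws <= C * (size (free_val f)).+1)%N].
  have [[C bC] [C' bC']] := (bound true, bound false); exists (C + C') => e f Qf.
  have [ws [Qws f_eq le_ws]] : exists ws, [/\ {subset ws <= Q}, free_val f ~ flatten ws
                 & (size ws <= (if e then C else C') * (size (free_val f)).+1)%N].
    by case: e Qf => Qf; [apply: bC | apply: bC'].
  by exists ws; split=> //; apply: leq_trans le_ws _; rewrite leq_mul2r; case: e {Qf}; lia.
have [D bD] : exists D, forall ws, {subset ws <= local_gens e} -> exists ws',
    [/\ {subset ws' <= Q}, flatten ws ~ flatten ws' & (size ws' <= D * size ws)%N].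
  have [D bD] : exists D, forall q, q \in local_gens e -> exists ws,
      [/\ {subset ws <= Q}, q ~ flatten ws & size ws <= D].
    have := @local_gens_word e; elim: (local_gens e) => [|q qs IHq] word_qs; first by exists 0.
    have [q' q'_in | D bD] := IHq; first by apply: word_qs; rewrite in_cons q'_in orbT.
    have [ws Qws ws_eq] := word_qs _ (mem_head _ _).
    exists (D + size ws) => q'; rewrite in_cons => /predU1P[-> | /bD[ws' [? ? le_ws']]].
      by exists ws; split=> //; apply: leq_addl.
    by exists ws'; split=> //; apply: leq_trans le_ws' (leq_addr _ _).
  exists D; elim=> [|q ws IHws] Qws; first by exists [::]; split=> //; apply: we_refl.
  have [ws1 [Qws1 eq1 le1]] := bD _ (Qws _ (mem_head _ _)).
  have [p p_in | ws2 [Qws2 eq2 le2]] := IHws; first by apply: Qws; rewrite in_cons p_in orbT.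
  exists (ws1 ++ ws2); split; last by rewrite size_cat /= mulnS leq_add.
    by move=> p; rewrite mem_cat => /orP[/Qws1 | /Qws2].
  by rewrite flatten_cat; apply: we_cat.
have [C bC] := bounded_product (local_gens e); exists (D * C)%N => f /bC[ws [Qws f_eq le_ws]].
have [ws' [Qws' ws'_eq le_ws']] := bD _ Qws; exists ws'; split=> //.
  by apply: we_trans ws'_eq; rewrite f_eq; apply: word_equiv_reduce.
by apply: leq_trans le_ws' _; rewrite -mulnA leq_mul2l le_ws orbT.
Qed.

Definition zeta_size := size (zeta true) + size (zeta false).

Lemma size_zpow e n : (size (free_val (zpow (edge e) n)) <= zeta_size * `|n|%N)%N.
Proof.
rewrite val_zpow size_zword mulnC leq_mul2r /zeta_size.
by case: e; rewrite (leq_addl, leq_addr) orbT.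
Qed.

(** If b.1 bounds the shift at the end of a factor of length k, then the factor times
    this shift has length at most k + zeta_size * b.1, so [zpow_bound] bounds the shift
    at its beginning by d. The second component bounds the number of generators in Q
    that are needed for the shifted factors. *)
Definition bound_step C k (b : nat * nat) :=
  let d := (k + zeta_size * b.1 + 2)%N in
  (d, (b.2 + C * (zeta_size * d + k + zeta_size * b.1 + 1))%N).

Definition list_bound C l := foldr (fun p => bound_step C (size (free_val p.2))) (0, 0) l.

Definition length_bound C (x : state) :=
  (C * (zeta_size * `|x.1| + 1) + (list_bound C x.2).2)%N.

(** Factors that differ by powers of zeta are in the submonoid together. *)
Lemma shifted_inside l n m r : z_inside -> shifted n l m r ->
    (forall p, p \in r -> product_of (local_gens p.1) p.2) ->
  forall p, p \in l -> product_of (local_gens p.1) p.2.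
Proof.
move=> z_in; elim: l n m r => [|[e s] l IHl] n m [|[e' s'] r] //= [eq_e [d s_eq sh_l]] Qr.
have Qr' : forall p, p \in r -> product_of (local_gens p.1) p.2.
  by move=> p p_in; apply: Qr; rewrite in_cons p_in orbT.
move=> p; rewrite in_cons => /predU1P[-> /= | ]; last exact: IHl sh_l Qr' p.
have -> : s = zpow (edge e) (- n)%R * (zpow (edge e) m * s' * zpow (edge e) d).
  by rewrite -s_eq zpowN mulKg.
apply: product_ofM; first exact: product_of_zpow.
apply: product_ofM; last exact: product_of_zpow.
apply: product_ofM; first exact: product_of_zpow.
by rewrite eq_e; apply: (Qr (e', s')); apply: mem_head.
Qed.

Section Bound.
Variable C : nat.
Hypothesis bC : forall e f, product_of (local_gens e) f ->
  exists ws, [/\ {subset ws <= Q}, free_val f ~ flatten ws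
               & (size ws <= C * (size (free_val f)).+1)%N].

Lemma list_bound_inside l : (forall p, p \in l -> product_of (local_gens p.1) p.2) ->
  exists ws, [/\ {subset ws <= Q}, state_word (0 : int, l) ~ flatten ws
               & size ws <= (list_bound C l).2].
Proof.
elim: l => [|[e s] l IHl] Ql; first by exists [::]; split=> //; apply: we_refl.
have [p p_in | ws [Qws eq_ws le_ws]] := IHl; first by apply: Ql; rewrite in_cons p_in orbT.
have [ws' [Qws' eq_ws' le_ws']] := bC (Ql (e, s) (mem_head _ _)).
exists (ws' ++ ws); split.
- by move=> p; rewrite mem_cat => /orP[/Qws' | /Qws].
- by rewrite flatten_cat; apply: (@we_cat _ _ (free_val s) _ (state_word (0 : int, l))).
rewrite size_cat addnC leq_add //; apply: leq_trans le_ws' _.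
by rewrite leq_mul2l /=; apply/orP; right; lia.
Qed.

(** The shifts are bounded one after the other, from the last factor to the first. *)
Lemma list_bound_outside l d r : ~ z_inside -> shifted d l 0 r ->
    (forall p, p \in r -> product_of (local_gens p.1) p.2) ->
  `|d|%N <= (list_bound C l).1 /\
  exists ws, [/\ {subset ws <= Q}, state_word (0 : int, r) ~ flatten ws
               & size ws <= (list_bound C l).2].
Proof.
move=> z_out; elim: l d r => [|[e s] l IHl] d [|[e' s'] r] //=.
  by move=> -> _; split=> //; exists [::]; split=> //; apply: we_refl.
case=> <-{e'} [d1 s_eq sh_l] Qr; rewrite mul1g in s_eq.
have [p p_in | le_d1 [ws [Qws eq_ws le_ws]]] := IHl _ _ sh_l.
  by apply: Qr; rewrite in_cons p_in orbT.
have Qs' := Qr (e, s') (mem_head _ _).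
have s'_eq : s' = zpow (edge e) d * (s * zpow (edge e) (- d1)%R).
  by rewrite mulgA s_eq zpowN mulgK.
have not_covers : ~ covers e by move=> covers_e; apply: z_out; case: (e) covers_e; [left | right].
have size_sd : (size (free_val (s * zpow (edge e) (- d1)%R)%g)
    <= size (free_val s) + zeta_size * (list_bound C l).1)%N.
  apply: leq_trans (size_free_mul _ _) _; rewrite leq_add2l.
  by apply: leq_trans (size_zpow _ _) _; rewrite leq_mul2l abszN le_d1 orbT.
have le_d : (`|d|%N <= size (free_val s) + zeta_size * (list_bound C l).1 + 2)%N.
  have Qd := Qs'; rewrite /= local_gens_outside // s'_eq in Qd.
  by have := zpow_bound not_covers Qd; lia.
split=> //.
have size_s' : (size (free_val s')
    <= zeta_size * (size (free_val s) + zeta_size * (list_bound C l).1 + 2)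
    + (size (free_val s) + zeta_size * (list_bound C l).1))%N.
  rewrite [in X in X <= _]s'_eq; apply: leq_trans (size_free_mul _ _) _.
  apply: leq_add size_sd; apply: leq_trans (size_zpow _ _) _.
  by rewrite leq_mul2l le_d orbT.
have [ws' [Qws' eq_ws' le_ws']] := bC Qs'.
exists (ws' ++ ws); split.
- by move=> p; rewrite mem_cat => /orP[/Qws' | /Qws].
- by rewrite flatten_cat; apply: (@we_cat _ _ (free_val s') _ (state_word (0 : int, r))).
rewrite size_cat addnC leq_add //; apply: leq_trans le_ws' _.
by rewrite leq_mul2l /=; apply/orP; right; lia.
Qed.

(** The computed alternating product is related by shifts to one with factors in the
    submonoid. If the powers of zeta are in the submonoid then its own factors are, too;
    otherwise the shifts are bounded. *)
Lemma length_boundP w ws : {subset ws <= Q} -> w ~ flatten ws ->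
  exists ws', [/\ {subset ws' <= Q}, w ~ flatten ws' & size ws' <= length_bound C (reduced_form w)].
Proof.
move=> Qws w_eq; have [[m r] [prop_r [/= Qr zr] r_eq]] := product_inside Qws.
have := reduced_form_equiv w; have := reduced_form_proper w.
rewrite /length_bound; case: (reduced_form w) => n l /= prop_l nl_eq.
have sh_l : shifted n l m r.
  apply: shifted_of_equiv => //; apply: we_trans nl_eq (we_trans w_eq (we_sym _)).
  exact/word_classP.
have [z_in | z_out] := pselect z_inside.
  have [ws2 [Qws2 eq_ws2 le_ws2]] := list_bound_inside (shifted_inside z_in sh_l Qr).
  have [ws1 [Qws1 eq_ws1 le_ws1]] := bC (product_of_zpow true n z_in).
  exists (ws1 ++ ws2); split.
  - by move=> p; rewrite mem_cat => /orP[/Qws1 | /Qws2].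
  - rewrite flatten_cat; apply: we_trans (we_sym nl_eq) _.
    by apply: we_cat eq_ws2; rewrite -val_zpow.
  rewrite size_cat leq_add //; apply: leq_trans le_ws1 _.
  by rewrite leq_mul2l addn1 ltnS size_zpow orbT.
have m0 : m = 0 by case: zr => // /z_out.
rewrite m0 in sh_l r_eq; have [_ [ws' [Qws' eq_ws' le_ws']]] := list_bound_outside z_out sh_l Qr.
exists ws'; split=> //; last exact: leq_trans le_ws' (leq_addl _ _).
apply: we_trans w_eq (we_trans _ eq_ws').
by apply/word_classP; rewrite -r_eq.
Qed.

End Bound.

End SurfaceAmalgam.

(** * Algorithms on words *)

Local Close Scope group_scope.

Definition fin_encoding (B : finType) : encoding B := fun x => enum_rank x.

Instance free_group_encoding (B : choiceType) (eB : encoding B) :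
  encoding (free_group B) := fun f => encode (free_val f).

Section WordAlgorithms.
Variable B : finType.

Let encB : encoding B := @fin_encoding B.
Local Existing Instance encB.

Notation letter := (B * bool)%type.

Lemma faithful_letter : @faithful letter _.
Proof.
apply: faithful_prod faithful_bool => x y.
by move/ord_inj/enum_rank_inj.
Qed.

Lemma faithful_word : @faithful (seq letter) _.
Proof. exact: faithful_seq faithful_letter. Qed.

Lemma faithful_free_group : @faithful (free_group B) _.
Proof. by move=> f h /faithful_word/val_inj. Qed.

Lemma computable_of_letter X (eX : encoding X) T (eT : encoding T) (h : letter -> T)
    (f : X -> letter) :
  computable f -> computable (fun x => h (f x)).
Proof.
move=> cf; apply: (computable_comp (g := h)) cf.
exact: computable_table faithful_letter.
Qed.

Lemma computable_reduce X (eX : encoding X) (f : X -> seq letter) :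
  computable f -> computable (fun x => reduce (f x)).
Proof.
move=> cf; apply: (computable_foldr (h := fun _ => @reduce_cons B)) cf (computable_const _ _ _) _.
pose h (p : X * (seq letter * letter)) y w :=
  if y == letter_inv p.2.2 then w else p.2.2 :: p.2.1.
apply: (computable_ext (f := fun p : X * (seq letter * letter) =>
    if p.2.1 is y :: w then h p y w else [:: p.2.2])); last first.
  by case=> x [[|y w] a].
apply: computable_case; first by comp_var.
  by apply: computable_cons; comp_var.
apply: computable_if; last by apply: computable_cons; comp_var.
  apply: (computable_equal (f := fun p => p.2.1)) faithful_letter _ _ _ (fun p => eqP).
    by comp_var.
  by apply: (computable_of_letter _ (@letter_inv B)); comp_var.
by comp_var.
Qed.

Lemma computable_word_inv X (eX : encoding X) (f : X -> seq letter) :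
  computable f -> computable (fun x => word_inv (f x)).
Proof.
move=> cf; apply: computable_rev.
apply: (computable_map (h := fun _ y => (y.1, ~~ y.2))) cf _.
by apply: (computable_of_letter _ (fun y => (y.1, ~~ y.2))); comp_var.
Qed.

Lemma computable_free_of X (eX : encoding X) (f : X -> seq letter) :
  computable f -> computable (fun x => free_of (f x)).
Proof. by move/computable_reduce. Qed.

Lemma computable_free_val X (eX : encoding X) (f : X -> free_group B) :
  computable f -> computable (fun x => free_val (f x)).
Proof. by []. Qed.

Lemma computable_free_mul X (eX : encoding X) (f h : X -> free_group B) :
  computable f -> computable h -> computable (fun x => f x * h x)%g.
Proof.
move=> cf ch; apply: computable_free_of.
exact: computable_cat (computable_free_val cf) (computable_free_val ch).
Qed.

Variables (R : set (word B)) (Q : seq (word B)).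

Definition products n : seq (word B) :=
  iter n (fun L => L ++ flatten [seq [seq q ++ w | w <- L] | q <- Q]) [:: [::]].

Lemma mem_products n w : w \in products n -> exists2 ws, {subset ws <= Q} & w = flatten ws.
Proof.
elim: n w => [|n IHn] w /=; first by rewrite inE => /eqP->; exists [::].
rewrite mem_cat => /orP[/IHn // | /flatten_mapP[q Qq /mapP[v /IHn[ws Qws ->] ->]]].
by exists (q :: ws) => // p; rewrite in_cons => /predU1P[-> | /Qws].
Qed.

Lemma products_flatten n ws : {subset ws <= Q} -> size ws <= n -> flatten ws \in products n.
Proof.
elim: n ws => [|n IHn] [|q ws] //= Qws le_ws.
  by rewrite mem_cat; apply/orP; left; apply: (IHn [::]).
rewrite mem_cat; apply/orP; right; apply/flatten_mapP; exists q; first exact/Qws/mem_head.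
apply/mapP; exists (flatten ws) => //; apply: IHn => //.
by move=> p p_in; apply: Qws; rewrite in_cons p_in orbT.
Qed.

Lemma computable_products X (eX : encoding X) (n : X -> nat) :
  computable n -> computable (fun x => products (n x)).
Proof.
move=> cn; pose h (_ : X) (L : seq (word B)) :=
  L ++ flatten [seq [seq q ++ w | w <- L] | q <- Q].
apply: (computable_iter (h := h)) cn (computable_const _ _ _) _.
apply: computable_cat; first by comp_var.
apply: computable_flatten.
apply: (computable_map (h := fun p q => [seq q ++ w | w <- p.2])).
  exact: computable_const.
apply: (computable_map (h := fun p w => p.2 ++ w)); first by comp_var.
by apply: computable_cat; comp_var.
Qed.

(** A bound on the number of factors reduces membership to finitely many instances of the
    word problem. *)
Lemma decidable_products (trivial : word B -> bool) (bound : word B -> nat) :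
    computable trivial -> (forall w, reflect (word_equiv R w [::]) (trivial w)) ->
    computable bound ->
    (forall w ws, {subset ws <= Q} -> word_equiv R w (flatten ws) ->
       exists ws', [/\ {subset ws' <= Q}, word_equiv R w (flatten ws')
                     & size ws' <= bound w]) ->
  decidable_language
    [set w : seq letter | exists2 ws, {subset ws <= Q} & word_equiv R w (flatten ws)]%classic.
Proof.
move=> ctriv trivP cbound boundP.
pose b (u : seq letter) := has (fun w => trivial (word_inv u ++ w)) (products (bound u)).
apply: (@decidable_language_computable _ _ _ b).
  apply: (computable_has (b := fun u w => trivial (word_inv u ++ w))).
    exact: computable_products.
  apply: (computable_comp ctriv); apply: computable_cat; last by comp_var.
  by apply: computable_word_inv; comp_var.
move=> u; apply: (iffP hasP) => [[w /mem_products[ws Qws w_eq] /trivP uw] | [ws Qws u_eq]].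
  exists ws => //; rewrite -w_eq -[X in word_equiv _ X _]cats0.
  apply: (@we_trans _ _ (u ++ (word_inv u ++ w))).
    by apply: we_cat; [apply: we_refl | apply: we_sym].
  rewrite catA -[X in word_equiv _ _ X]cat0s; apply: we_cat; last exact: we_refl.
  exact: word_equiv_mulV.
have [ws' [Qws' u_eq' le_ws']] := boundP _ _ Qws u_eq.
exists (flatten ws'); first exact: products_flatten.
apply/trivP; apply: (@we_trans _ _ (word_inv u ++ u)).
  by apply: we_cat; [apply: we_refl | apply: we_sym].
by apply: word_equiv_of_reduce; rewrite reduce_mulVl.
Qed.

End WordAlgorithms.

(** * Algorithms for the amalgam *)

(** The sign and the absolute value are projections of the code. *)
Instance int_encoding : encoding int :=
  fun n => match n with Posz k => npair 0 k | Negz k => npair 1 k.+1 end.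

Lemma faithful_int : faithful int_encoding.
Proof. by move=> [k|k] [k'|k'] /npair_inj[] // _ => [-> | [->]]. Qed.

Lemma computable_posz X (eX : encoding X) (f : X -> nat) :
  computable f -> computable (fun x => Posz (f x)).
Proof. by move=> cf; apply: (computable_pair (computable_const _ _ 0) cf). Qed.

Lemma computable_negz X (eX : encoding X) (f : X -> nat) :
  computable f -> computable (fun x => Negz (f x)).
Proof.
by move=> cf; apply: (computable_pair (computable_const _ _ 1) (computable_succ cf)).
Qed.

Lemma computable_abs X (eX : encoding X) (f : X -> int) :
  computable f -> computable (fun x => `|f x|%N).
Proof.
case=> phi rphi phiE; exists (fun n => nsnd (phi n)) => [|x].
  exact: rec1_comp rec1_snd rphi.
by rewrite phiE; case: (f x) => k; rewrite [LHS]npairK2.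
Qed.

Lemma computable_neg X (eX : encoding X) (f : X -> int) :
  computable f -> computable (fun x => if f x is Negz _ then true else false).
Proof.
case=> phi rphi phiE; exists (fun n => nfst (phi n)) => [|x].
  exact: rec1_comp rec1_fst rphi.
by rewrite phiE; case: (f x) => k; rewrite [LHS]npairK1.
Qed.

Section SurfaceAlgorithms.
Variable B : finType.
Variables (side : B -> bool) (zeta : bool -> word B).
Let encB : encoding B := @fin_encoding B.
Local Existing Instance encB.
Notation letter := (B * bool)%type.

Lemma computable_zword X (eX : encoding X) (w : seq letter) (f : X -> int) :
  computable f -> computable (fun x => zword w (f x)).
Proof.
move=> cf; apply: (computable_ext (f := fun x =>
  if if f x is Negz _ then true else false then flatten (nseq `|f x|%N (word_inv w))
  else flatten (nseq `|f x|%N w))); last by move=> x; case: (f x).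
apply: computable_if; first exact: computable_neg.
  by apply: computable_flatten; apply: computable_nseq (computable_abs cf) (computable_const _ _ _).
by apply: computable_flatten; apply: computable_nseq (computable_abs cf) (computable_const _ _ _).
Qed.

Lemma computable_zword_side X (eX : encoding X) (e : X -> bool) (f : X -> int) :
  computable e -> computable f -> computable (fun x => zword (zeta (e x)) (f x)).
Proof.
move=> ce cf; apply: (computable_ext (f := fun x =>
  if e x then zword (zeta true) (f x) else zword (zeta false) (f x))).
  exact: computable_if ce (computable_zword _ cf) (computable_zword _ cf).
by move=> x; case: (e x).
Qed.

Lemma computable_zpow X (eX : encoding X) (e : X -> bool) (f : X -> int) :
  computable e -> computable f -> computable (fun x => zpow (edge zeta (e x)) (f x)).
Proof.
move=> ce cf; apply: (computable_ext (f := fun x => free_of (zword (zeta (e x)) (f x)))).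
  by apply: computable_free_of; apply: computable_zword_side.
by move=> x; rewrite free_of_zword.
Qed.

Lemma computable_zlogs X (eX : encoding X) (e : X -> bool) (f : X -> free_group B) :
  computable e -> computable f -> computable (fun x => zlogs zeta (e x) (f x)).
Proof.
move=> ce cf.
have cv := computable_free_val cf.
have ci : computable (fun x => iota 0 (size (free_val (f x))).+1).
  by apply: computable_iota; apply: computable_succ; apply: computable_size.
apply: (computable_filter (b := fun x n => zword (zeta (e x)) n == free_val (f x))).
  apply: computable_cat.
    apply: (computable_map (h := fun _ => Posz)) ci _.
    by apply: computable_posz; comp_var.
  apply: (computable_map (h := fun _ => Negz)) ci _.
  by apply: computable_negz; comp_var.
apply: (computable_equal (f := fun p => zword (zeta (e p.1)) p.2)
  (g := fun p => free_val (f p.1))) (@faithful_word B) _ _ _ (fun p => eqP).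
  apply: computable_zword_side; last by comp_var.
  by apply: (computable_comp ce); comp_var.
by apply: (computable_comp cv); comp_var.
Qed.

Notation state := (state (free_group B)).

Lemma computable_peel X (eX : encoding X) (e : X -> bool) (f : X -> state) :
  computable e -> computable f -> computable (fun x => peel (edge zeta) (e x) (f x)).
Proof.
move=> ce cf.
have c1 := computable_fst cf; have c2 := computable_snd cf.
pose h x (p : bool * free_group B) (l : seq (bool * free_group B)) :=
  if p.1 == e x then (zpow (edge zeta (e x)) (f x).1 * p.2, l)%g
  else (zpow (edge zeta (e x)) (f x).1, (f x).2).
apply: (computable_ext (f := fun x => if (f x).2 is p :: l then h x p l
  else (zpow (edge zeta (e x)) (f x).1, (f x).2))); last first.
  by move=> x; rewrite /h /peel; case: (f x).2 => [|[]].
have cz := computable_zpow ce c1.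
have cz1 : computable (fun p : X * ((bool * free_group B) * seq (bool * free_group B)) =>
    zpow (edge zeta (e p.1)) (f p.1).1).
  by apply: (computable_comp cz); comp_var.
apply: (computable_case c2 (computable_pair cz c2)).
apply: computable_if.
- apply: (computable_equal (f := fun p => p.2.1.1) (g := fun p => e p.1))
    faithful_bool _ _ _ (fun p => eqP); first by comp_var.
  by apply: (computable_comp ce); comp_var.
- apply: computable_pair; last by comp_var.
  by apply: (computable_free_mul cz1); comp_var.
apply: (computable_pair cz1).
by apply: (computable_comp c2); comp_var.
Qed.

Lemma computable_state_mul X (eX : encoding X) (e : X -> bool) (f : X -> free_group B)
    (x : X -> state) :
  computable e -> computable f -> computable x ->
  computable (fun t => state_mul zeta (e t) (f t) (x t)).
Proof.
move=> ce cf cx; have cp := computable_peel ce cx.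
have ch := computable_free_mul cf (computable_fst cp).
have cz := computable_zlogs ce ch.
apply: (computable_case (h := fun t n _ => (n, (peel (edge zeta) (e t) (x t)).2))) cz _ _.
  apply: computable_pair; first by comp_var.
  exact: computable_cons (computable_pair ce ch) (computable_snd cp).
apply: computable_pair; first by comp_var.
apply: (computable_comp (computable_snd cp)); by comp_var.
Qed.

Lemma computable_reduced_form : computable (reduced_form side zeta).
Proof.
apply: (computable_foldr (h := fun _ y => state_mul zeta (side y.1) (free_of [:: y]))).
- by comp_var.
- by comp_var.
apply: computable_state_mul; last by comp_var.
  by apply: (computable_of_letter _ (fun y : letter => side y.1)); comp_var.
by apply: (computable_of_letter _ (fun y : letter => free_of [:: y])); comp_var.
Qed.

Lemma computable_length_bound C : computable (length_bound zeta C).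
Proof.
apply: computable_add.
  apply: computable_mul; first by comp_var.
  apply: computable_add; last by comp_var.
  apply: computable_mul; first by comp_var.
  by apply: computable_abs; comp_var.
apply: computable_snd.
apply: (computable_foldr (h := fun _ p => bound_step zeta C (size (free_val p.2)))).
- by comp_var.
- by comp_var.
pose D := (state * ((nat * nat) * (bool * free_group B)))%type.
have cs : computable (fun p : D => size (free_val p.2.2.2)).
  by apply: computable_size; apply: computable_free_val; comp_var.
have cb : computable (fun p : D => zeta_size zeta * p.2.1.1).
  by apply: computable_mul; comp_var.
have cd : computable (fun p : D => size (free_val p.2.2.2) + zeta_size zeta * p.2.1.1 + 2).
  by apply: (computable_add (computable_add cs cb)); comp_var.
apply: (computable_pair cd).
apply: computable_add; first by comp_var.
apply: computable_mul; first by comp_var.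
apply: computable_add; last by comp_var.
have cm : computable (fun p : D => zeta_size zeta *
      (size (free_val p.2.2.2) + zeta_size zeta * p.2.1.1 + 2)).
  by apply: computable_mul => //; comp_var.
exact: computable_add (computable_add cm cs) cb.
Qed.

Hypothesis zeta_cycle : forall e, cycle (@apart B) (zeta e).
Hypothesis zeta_neq0 : forall e, zeta e != [::].
Hypothesis mem_zeta : forall e x, (x \in zeta e) = (side x.1 == e).
Variable Q : seq (word B).
Hypothesis Q_powers : forall q, q \in Q -> exists k x, q = nseq k x.

Let R : set (word B) := [set zeta true ++ word_inv (zeta false)]%classic.

Theorem decidable_amalgam : decidable_language
  [set w : seq letter | exists2 ws, {subset ws <= Q} & word_equiv R w (flatten ws)]%classic.
Proof.
have [C bC] := product_word mem_zeta Q.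
apply: (@decidable_products _ _ _ (fun w => reduced_form side zeta w == (0%Z, [::]))
                                  (fun w => length_bound zeta C (reduced_form side zeta w))).
- have faithful_state : @faithful state _.
    apply: faithful_prod faithful_int _.
    exact: faithful_seq (faithful_prod faithful_bool (@faithful_free_group B)).
  apply: (computable_equal (f := reduced_form side zeta)) faithful_state _ _ _ (fun w => eqP).
    exact: computable_reduced_form.
  by comp_var.
- by move=> w; apply: (iffP eqP) => /(reduced_form_trivial zeta_cycle zeta_neq0 mem_zeta).
- exact: computable_comp (computable_length_bound C) computable_reduced_form.
by move=> w ws; apply: length_boundP.
Qed.

End SurfaceAlgorithms.

(** * Two commuting free groups *)

Section CommutingSides.
Variables (B : finType) (side : B -> bool) (R : set (word B)).
Notation letter := (B * bool)%type.
Let encB : encoding B := @fin_encoding B.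
Local Existing Instance encB.
Implicit Types (u v w : word B) (x y : B * bool) (e : bool).
Notation "u ~ v" := (word_equiv R u v) (at level 70).

Definition side_part e w : word B := [seq x <- w | side x.1 == e].

Hypothesis relator_part : forall r, R r -> forall e, reduce (side_part e r) = [::].
Hypothesis sides_commute : forall x y, side x.1 != side y.1 -> [:: x; y] ~ [:: y; x].

Lemma side_part_cat e u v : side_part e (u ++ v) = side_part e u ++ side_part e v.
Proof. exact: filter_cat. Qed.

Lemma side_part_equiv e u v : u ~ v -> reduce (side_part e u) = reduce (side_part e v).
Proof.
elim=> {u v} [u | u v _ -> | v u w _ -> _ -> | u u' v v' _ IHu _ IHv | b b' | r /relator_part->] //.
  by rewrite !side_part_cat -reduce_catl -reduce_catr IHu IHv reduce_catl reduce_catr.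
by rewrite /side_part /=; case: eqP => //= _; rewrite eqxx.
Qed.

Lemma side_letter_comm x w : (forall y, y \in w -> side x.1 != side y.1) -> x :: w ~ rcons w x.
Proof.
elim: w => [|y w IHw] side_w; first exact: we_refl.
apply: (@we_trans _ _ (y :: x :: w)).
  apply: (@we_cat _ _ [:: x; y] [:: y; x] w w); last exact: we_refl.
  by apply: sides_commute; apply: side_w; apply: mem_head.
apply: (@we_cat _ _ [:: y] [:: y] (x :: w)); first exact: we_refl.
by apply: IHw => t t_in; apply: side_w; rewrite in_cons t_in orbT.
Qed.

Lemma side_part_split w : w ~ side_part true w ++ side_part false w.
Proof.
elim: w => [|x w IHw] /=; first exact: we_refl.
apply: (@we_trans _ _ (x :: side_part true w ++ side_part false w)).
  by apply: (@we_cat _ _ [:: x] [:: x]); first exact: we_refl.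
case side_x: (side x.1) => /=; first exact: we_refl.
rewrite -cat_rcons -cat_cons; apply: we_cat; last exact: we_refl.
apply: side_letter_comm => y; rewrite mem_filter => /andP[/eqP-> _].
by rewrite side_x.
Qed.

Variable Q : seq (word B).
Hypothesis Q_powers : forall q, q \in Q -> exists k x, q = nseq k x.

(** Each word of Q lies on one side, so its part on the other side is empty. *)
Lemma side_part_product e ws : {subset ws <= Q} ->
  product_of [seq q <- Q | on_side side e q] (free_of (side_part e (flatten ws))).
Proof.
elim: ws => [|q ws IHws] Qws; first exact: product_of1.
have Qq := Qws _ (mem_head _ _).
rewrite /= side_part_cat free_of_cat; apply: product_ofM; last first.
  by apply: IHws => p p_in; apply: Qws; rewrite in_cons p_in orbT.
have [on_q | off_q] := boolP (on_side side e q).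
  rewrite /side_part (all_filterP on_q).
  by apply: product_of_mem; rewrite mem_filter on_q.
suff -> : side_part e q = [::] by apply: product_of1.
have [k [x q_eq]] := Q_powers Qq; move: off_q; rewrite q_eq /on_side all_nseq negb_or.
case/andP=> _ /negPf side_x; elim: k {q_eq} => //= k ->.
by rewrite side_x.
Qed.

(** The group is the product of two groups that are free on one side each. Both parts of
    a member are products of powers on the same side, in a free group, where the number
    of factors is bounded. *)
Theorem decidable_commuting : decidable_language
  [set w : seq letter | exists2 ws, {subset ws <= Q} & w ~ flatten ws]%classic.
Proof.
pose Qe e := [seq q <- Q | on_side side e q].
have [[C bC] [D bD]] := (bounded_product (Qe true), bounded_product (Qe false)).
have csize : computable (fun w : seq letter => (C + D) * (size w).+1).
  apply: computable_mul; first by comp_var.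
  by apply: computable_succ; apply: computable_size; comp_var.
have cpart e : computable (fun w : seq letter => reduce (side_part e w) == [::]).
  apply: (computable_equal (f := fun w => reduce (side_part e w))) (@faithful_word B) _ _ _
    (fun w => eqP); last by comp_var.
  apply: computable_reduce; apply: (computable_filter (b := fun _ x => side x.1 == e)).
    by comp_var.
  by apply: (computable_of_letter _ (fun x : letter => side x.1 == e)); comp_var.
apply: (@decidable_products _ _ _ (fun w => (reduce (side_part true w) == [::]) &&
  (reduce (side_part false w) == [::])) (fun w => (C + D) * (size w).+1)) => //.
- apply: computable_if; [exact: cpart | exact: cpart | by comp_var].
- move=> w; apply: (iffP andP) => [[/eqP part_t /eqP part_f] | w1].
    apply: we_trans (side_part_split w) _.
    by apply: word_equiv_of_reduce; rewrite -reduce_catl -reduce_catr part_t part_f.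
  by rewrite !(side_part_equiv _ w1).
move=> w ws Qws w_eq.
have part_product e : product_of (Qe e) (free_of (side_part e w)).
  suff -> : free_of (side_part e w) = free_of (side_part e (flatten ws)).
    exact: side_part_product.
  by apply/eqP/free_ofP/side_part_equiv.
have le_part e : size (reduce (side_part e w)) <= size w.
  by apply: leq_trans (size_reduce _) _; rewrite size_filter count_size.
have [ws1 [Qws1 /(congr1 (@free_val _)) eq1 le1]] := bC _ (part_product true).
have [ws2 [Qws2 /(congr1 (@free_val _)) eq2 le2]] := bD _ (part_product false).
exists (ws1 ++ ws2); split.
- move=> q; rewrite mem_cat => /orP[/Qws1 | /Qws2]; by rewrite mem_filter => /andP[].
- apply: we_trans (side_part_split w) _; rewrite flatten_cat.
  by apply: we_cat; apply: word_equiv_of_reduce.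
rewrite size_cat mulnDl leq_add //; [apply: leq_trans le1 _ | apply: leq_trans le2 _].
  by rewrite leq_mul2l ltnS le_part orbT.
by rewrite leq_mul2l ltnS le_part orbT.
Qed.

End CommutingSides.

(** * Surface groups *)

Section SurfaceRelator.
Variable g : nat.
Local Notation L := (surface_letters g).

Definition handle (i : 'I_g) : word L := word_comm [:: (inl i, false)] [:: (inr i, false)].

Definition index_of (b : L) : 'I_g := match b with inl i | inr i => i end.

Lemma mem_handles (s : seq 'I_g) (x : L * bool) :
  (x \in flatten [seq handle i | i <- s]) = (index_of x.1 \in s).
Proof.
elim: s => // i s IHs.
change ((x \in handle i ++ flatten [seq handle j | j <- s]) = (index_of x.1 \in i :: s)).
rewrite mem_cat IHs in_cons; congr (_ || _).
by case: x {IHs} => [[j|j] []]; rewrite /handle /word_comm /= !inE !xpair_eqE /=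
    ?andbT ?andbF //= ?orbF;
  apply/eqP/eqP => [[]|->].
Qed.

Lemma handles_cycle (s : seq 'I_g) : cycle (@apart L) (flatten [seq handle i | i <- s]).
Proof.
have path_s (j k : 'I_g) e e' t :
    path (@apart L) (inr j, e) (rcons (flatten [seq handle i | i <- t]) (inl k, e')).
  by elim: t j e => //= i t IHt j e; rewrite IHt.
by case: s => //= i s; rewrite path_s.
Qed.

End SurfaceRelator.

Lemma submonoid_gen_products (B : finType) (R : set (word B)) (P : set (presented R)) :
    finite_set P ->
    (forall x, P x -> exists (l : B * bool) n,
       x = (letter_eval (@presented_gen B R) l ^+ n)%g) ->
  exists2 Q : seq (word B), (forall q, q \in Q -> exists k x, q = nseq k x) &
    forall w, submonoid_gen P (word_class R w) <->
      exists2 ws, {subset ws <= Q} & word_equiv R w (flatten ws).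
Proof.
move=> /finite_seqP[s P_eq] P_powers.
have [Q Q_powers QE] : exists2 Q : seq (word B),
    (forall q, q \in Q -> exists k x, q = nseq k x) &
    forall x, x \in s <-> exists2 q, q \in Q & word_class R q = x.
  have {}P_powers x : x \in s -> exists (l : B * bool) n,
      x = (letter_eval (@presented_gen B R) l ^+ n)%g.
    by move=> sx; apply: P_powers; rewrite P_eq.
  elim: s {P_eq} P_powers => [|x s IHs] x_power.
    by exists [::] => // x; split=> // -[].
  have [y sy | Q Q_powers QE] := IHs; first by apply: x_power; rewrite in_cons sy orbT.
  have [l [n x_eq]] := x_power x (mem_head _ _).
  have x_class : word_class R (nseq n l) = x.
    rewrite x_eq -word_eval_presented /word_eval.
    by elim: n {x_eq} => [|n IHn]; rewrite /= ?big_nil ?big_cons ?expg0 ?expgS ?IHn.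
  exists (nseq n l :: Q) => [q | y].
    by rewrite in_cons => /predU1P[-> | /Q_powers] //; exists n, l.
  rewrite in_cons; split=> [/predU1P[-> | /QE[q Qq <-]] | [q]].
  - by exists (nseq n l); rewrite ?mem_head.
  - by exists q; rewrite // in_cons Qq orbT.
  rewrite in_cons => /predU1P[-> <- | Qq <-]; first by rewrite x_class eqxx.
  by apply/orP; right; apply/QE; exists q.
exists Q => // w; split=> [Mw | [ws Qws w_eq] N [[N1 NM] NP]].
  pose N x := exists2 ws, {subset ws <= Q} & x = word_class R (flatten ws).
  suff [ws Qws /word_classP w_eq] : N (word_class R w) by exists ws.
  apply: Mw; split; last first.
    move=> x; rewrite P_eq => /QE[q Qq <-]; exists [:: q]; last by rewrite /= cats0.
    by move=> p; rewrite inE => /eqP->.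
  split=> [|x y [ws Qws ->] [ws' Qws' ->]]; first by exists [::].
  exists (ws ++ ws'); last by rewrite flatten_cat -word_class_cat.
  by move=> p; rewrite mem_cat => /orP[/Qws | /Qws'].
have -> : word_class R w = word_class R (flatten ws) by apply/word_classP.
elim: ws Qws {w_eq} => [|q ws IHws] Qws; first exact: N1.
rewrite /= -word_class_cat; apply: NM; last first.
  by apply: IHws => p p_in; apply: Qws; rewrite in_cons p_in orbT.
apply: NP; rewrite P_eq; apply/QE; exists q => //.
by apply: Qws; apply: mem_head.
Qed.

Local Open Scope classical_set_scope.

Theorem corollary6p29 (g : nat) (hg : (1 <= g)%N)
    (P : set (surface_group g)) (P_finite : finite_set P)
    (P_powers : P `<=` @generator_powers g) :
  membership_decidable (@surface_gen g) (submonoid_gen P).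
Proof.
have [Q Q_powers QE] := submonoid_gen_products P_finite P_powers.
rewrite /membership_decidable.
have -> : [set w | submonoid_gen P (word_eval (@surface_gen g) w)]%classic
  = [set w | exists2 ws, {subset ws <= Q} &
       word_equiv [set surface_relator g]%classic w (flatten ws)]%classic.
  by apply/funext => w; apply/propext; rewrite /= word_eval_presented; apply: QE.
case: g hg P {P_finite P_powers QE} Q Q_powers => [|[|n]] // _ _ Q Q_powers.
  (* The torus group is the product of two infinite cyclic groups. *)
  pose side (b : surface_letters 1) := if b is inl _ then true else false.
  apply: (@decidable_commuting _ side) => //.
    move=> r -> e; rewrite /surface_relator enum_ordSl enum_ord0 /=.
    by case: e.
  move=> x y side_xy; apply/word_classP.
  rewrite -!word_eval_presented /word_eval !big_cons !big_nil !mulg1.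
  have comm_gen (i j : 'I_1) : commute (surface_gen (inl i)) (surface_gen (inr j)).
    have := surface_relation 1; rewrite big_ord1 !ord1 => rel.
    by rewrite /commute -[RHS]mul1g -rel mulgA !mulgVK.
  have comm_letter z t : side z.1 -> ~~ side t.1 ->
      commute (letter_eval (@surface_gen 1) z) (letter_eval (@surface_gen 1) t).
    case: z t => [[i|i] e] [[j|j] e'] //= _ _; have comm_ij := comm_gen i j.
    by case: e e' => -[]; do ?[exact: comm_ij | apply: commuteV | apply: commute_sym].
  case side_x: (side x.1) side_xy => side_y; [|symmetry]; apply: comm_letter => //.
    by move: side_y; case: (side y.1).
  by rewrite side_x.
(* The first handle is cut off. *)
pose side (b : surface_letters n.+2) := index_of b == ord0.
pose rest : word (surface_letters n.+2) := flatten [seq handle i | i <- enum 'I_n.+2 & i != ord0].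
pose zeta e := if e then handle (ord0 : 'I_n.+2) else word_inv rest.
have -> : surface_relator n.+2 = zeta true ++ word_inv (zeta false).
  rewrite /= word_invK /rest /surface_relator enum_ordSl /=; congr (handle _ ++ _).
  rewrite (_ : [seq i <- _ | _] = [seq lift ord0 i | i <- enum 'I_n.+1]) //.
  by apply/all_filterP/allP => _ /mapP[i _ ->].
apply: (@decidable_amalgam _ side) => //.
- case; first exact: (handles_cycle [:: ord0 : 'I_n.+2]).
  exact: cycle_apart_inv (handles_cycle _).
- case=> //; rewrite -size_eq0 size_word_inv size_eq0.
  apply/eqP => rest_nil.
  have : (inl (lift ord0 ord0), true) \in rest by rewrite mem_handles mem_filter mem_enum.
  by rewrite rest_nil.
case=> x; first by rewrite eqb_id; have := mem_handles [:: ord0 : 'I_n.+2] x; rewrite mem_seq1.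
rewrite mem_word_inv mem_handles mem_filter mem_enum andbT.
by rewrite eqbF_neg.
Qed.
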